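(* Let $H$ be a graph with $\chi(H)=r\ge 3$. If $$\delta_\chi(H)\in\left\{\frac{r-3}{r-2},\ \frac{2r-5}{2r-3}\right\},$$ then $\delta_\chi(H)\le\delta_{\mathrm{VC}}(H)$.
   Context: All graphs are finite and simple. A graph is $H$-free if it contains no (not necessarily induced) subgraph isomorphic to $H$; it is maximal $H$-free if it is $H$-free and adding any missing edge creates a copy of $H$. $\delta(G)$ denotes minimum degree and $\chi$ the chromatic number. The chromatic threshold $\delta_\chi(H)$ is the infimum of all $\gamma>0$ for which there is a constant $C=C(\gamma,H)$ such that every $H$-free graph $G$ with $\delta(G)\ge\gamma|V(G)|$ has $\chi(G)\le C$. The VC-dimension $\mathrm{VC}(G)$ of a graph $G$ is the maximum size of a set $S\subseteq V(G)$ such that $\{N_G(v)\cap S: v\in V(G)\}=2^S$. The VC-dimension threshold $\delta_{\mathrm{VC}}(H)$ is the infimum of all $\gamma\ge 0$ for which there exists a constant $C=C(\gamma,H)$ such that every maximal $H$-free graph $G$ with $\delta(G)\ge\gamma|V(G)|$ satisfies $\mathrm{VC}(G)\le C$. *)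

(* Defs.v *)
From HB Require Import structures.
From mathcomp Require Import all_boot all_order all_algebra.
From mathcomp Require Import boolp classical_sets reals.

Set Implicit Arguments.
Unset Strict Implicit.
Unset Printing Implicit Defensive.

Import Order.TTheory GRing.Theory Num.Theory.

Local Open Scope nat_scope.

Record sgraph := SGraph {
  vertex :> finType;
  adj : rel vertex;
  adj_sym : symmetric adj;
  adj_irrefl : irreflexive adj
}.

Definition nbhd (G : sgraph) (v : G) : {set G} := [set u | adj v u].

Definition degree (G : sgraph) (v : G) : nat := #|nbhd v|.

(* Every degree is smaller than #|G|, so the default value of the minimum is
   only reached by the graph without vertices, for which it is 0. *)
Definition min_degree (G : sgraph) : nat :=
  \big[minn/#|G|]_(v : G) degree v.

Definition colorable (G : sgraph) (k : nat) : bool :=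
  [exists c : {ffun G -> 'I_k}, forall x, forall y, adj x y ==> (c x != c y)].

Lemma colorable_card (G : sgraph) : exists k, colorable G k.
Proof.
exists #|G|; apply/existsP; exists [ffun x => enum_rank x].
apply/forallP=> x; apply/forallP=> y; apply/implyP=> xy; rewrite !ffunE.
by apply: contraTneq xy => /enum_rank_inj ->; rewrite adj_irrefl.
Qed.

Definition chromatic_number (G : sgraph) : nat := ex_minn (colorable_card G).

(* G has a subgraph, not necessarily induced, isomorphic to H. *)
Definition contains (H G : sgraph) : Prop :=
  exists f : H -> G, injective f /\ forall x y, adj x y -> adj (f x) (f y).

Definition free (H G : sgraph) : Prop := ~ contains H G.

Definition add_edge_rel (G : sgraph) (u v : G) : rel G :=
  fun x y => adj x y || ((x != y) && ([set x; y] == [set u; v])).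

Lemma add_edge_sym (G : sgraph) (u v : G) : symmetric (add_edge_rel u v).
Proof. by move=> x y; rewrite /add_edge_rel adj_sym eq_sym finset.setUC. Qed.

Lemma add_edge_irrefl (G : sgraph) (u v : G) : irreflexive (add_edge_rel u v).
Proof. by move=> x; rewrite /add_edge_rel adj_irrefl eqxx. Qed.

Definition add_edge (G : sgraph) (u v : G) : sgraph :=
  SGraph (add_edge_sym u v) (add_edge_irrefl u v).

Definition maximal_free (H G : sgraph) : Prop :=
  free H G /\
  forall u v : G, u != v -> ~~ adj u v -> contains H (add_edge u v).

Definition shattered (G : sgraph) (S : {set G}) : bool :=
  [set nbhd v :&: S | v : G] == powerset S.

Definition VC_dim (G : sgraph) : nat :=
  \max_(S : {set G} | shattered S) #|S|.

Local Open Scope classical_set_scope.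
Local Open Scope ring_scope.

(* The sets below are bounded below by 0 and contain every gamma > 1, since
   min_degree G < #|G| for nonempty G; hence inf is a genuine infimum. *)
Definition chromatic_threshold (R : realType) (H : sgraph) : R :=
  inf [set gamma : R | 0 < gamma /\
    exists C : nat, forall G : sgraph, free H G ->
      gamma * #|G|%:R <= (min_degree G)%:R -> (chromatic_number G <= C)%N].

Definition VC_threshold (R : realType) (H : sgraph) : R :=
  inf [set gamma : R | 0 <= gamma /\
    exists C : nat, forall G : sgraph, maximal_free H G ->
      gamma * #|G|%:R <= (min_degree G)%:R -> (VC_dim G <= C)%N].

(* Main.v *)
Require Import Defs.
From HB Require Import structures.
From mathcomp Require Import all_boot all_order all_algebra.
From mathcomp Require Import boolp classical_sets reals.
From mathcomp Require Import zify lra.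
Import fintype boot.finset boot.finset.finset.

(** Lower bound: the VC-dimension threshold of H is always at least (r-3)/(r-2). Among the graphs left
    after removing r-3 disjoint independent sets from H, let F have the largest odd girth g. A partite
    amalgamation over the edges of F gives a graph L without odd cycles of length at most g, such that
    every graph of small VC-dimension extending L on the same vertices contains F. The complete
    (r-2)-partite graph with L inserted into one part is H-free, and all of its H-free extensions have
    large VC-dimension.

    Upper bound: let gamma > (r-3)/(r-2) bound the VC-dimension of maximal H-free graphs. Every
    neighbourhood contains a positive proportion of the complete (r-2)-partite tuples with parts of size s,
    so by the epsilon-net theorem boundedly many such tuples have common neighbourhoods covering the graph.
    If the chromatic threshold is below (r-2)/(r-1), every graph with large chromatic number contains
    what is left of H after removing some r-2 independent sets; hence each common neighbourhood has bounded
    chromatic number and the chromatic threshold is at most gamma. *)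

Set Implicit Arguments.
Unset Strict Implicit.
Unset Printing Implicit Defensive.

Import Order.TTheory GRing.Theory Num.Theory.

Local Open Scope nat_scope.

(** * Set families *)

Definition shatters (T : finType) (A : {set {set T}}) (S : {set T}) : bool :=
  powerset S \subset [set B :&: S | B in A].

Lemma shattersP (T : finType) (A : {set {set T}}) (S : {set T}) :
  reflect (forall U : {set T}, U \subset S -> exists2 B, B \in A & U = B :&: S)
          (shatters A S).
Proof.
apply: (iffP subsetP) => [h U US | h U].
  by have /imsetP[B BA ->] : U \in [set B :&: S | B in A]
    by [apply: h; rewrite powersetE]; exists B.
by rewrite powersetE => /h[B BA ->]; apply: imset_f.
Qed.

Lemma shatters_sub (T : finType) (A B : {set {set T}}) (S : {set T}) :
  A \subset B -> shatters A S -> shatters B S.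
Proof. by move=> AB h; apply: (subset_trans h); apply: imsetS. Qed.

(* Pajor's strengthening of Sauer-Shelah: it makes the induction on the family go through. *)
Lemma card_shatters (T : finType) (A : {set {set T}}) :
  #|A| <= #|[set S | shatters A S]|.
Proof.
elim: {A}_.+1 {-2}A (ltnSn #|A|) => // n IH A; rewrite ltnS => An.
have [A1|A1] := leqP #|A| 1.
  have [->|[B BA]] := set_0Vmem A; first by rewrite cards0.
  apply: (leq_trans A1); rewrite card_gt0; apply/set0Pn; exists set0.
  rewrite inE; apply/shattersP => U; rewrite subset0 => /eqP->.
  by exists B; rewrite // setI0.
have [B BA [C CA BC]] : exists2 B, B \in A & exists2 C, C \in A & B != C.
  have /card_gt0P[B BA] : 0 < #|A| by lia.
  have : 0 < #|A :\ B| by have := cardsD1 B A; rewrite BA; lia.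
  by case/card_gt0P=> C; rewrite !inE => /andP[CB CA]; exists B => //; exists C;
    rewrite 1?eq_sym.
have [x xBC] : exists x, (x \in B) != (x \in C).
  apply/existsP; apply: contraNT BC; rewrite negb_exists => /forallP h.
  by apply/eqP/setP=> x; have := h x; rewrite negbK => /eqP.
pose A0 := [set D in A | x \notin D]; pose A1' := [set D in A | x \in D].
have cA : #|A| = #|A0| + #|A1'|.
  rewrite -(cardsID [set D : {set T} | x \in D] A) addnC.
  by congr (_ + _); apply: eq_card => D; rewrite !inE // andbC.
have sA0 : A0 \subset A by apply/subsetP=> D; rewrite inE => /andP[].
have sA1 : A1' \subset A by apply/subsetP=> D; rewrite inE => /andP[].
have pos0 : 0 < #|A0| /\ 0 < #|A1'|.
  rewrite !card_gt0; split; apply/set0Pn.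
    by case xB: (x \in B) xBC => xC; [exists C|exists B];
       rewrite inE ?CA ?BA ?xB //=; case: (x \in C) xC.
  by case xB: (x \in B) xBC => xC; [exists B|exists C];
     rewrite inE ?CA ?BA ?xB //=; case: (x \in C) xC.
have h0 : #|A0| <= #|[set S | shatters A0 S]| by apply: IH; lia.
have h1 : #|A1'| <= #|[set S | shatters A1' S]| by apply: IH; lia.
set S0 := [set S | shatters A0 S] in h0; set S1 := [set S | shatters A1' S] in h1.
have x0 S : S \in S0 -> x \notin S.
  rewrite inE => /shattersP h; apply/negP => xS.
  by have [D] := h S (subxx _); rewrite inE => /andP[_ xD] /setP/(_ x); rewrite inE xS (negPf xD).
have x1 S : S \in S1 -> x \notin S.
  rewrite inE => /shattersP h; apply/negP => xS.
  by have [D] := h set0 (sub0set _); rewrite inE => /andP[_ xD] /setP/(_ x); rewrite !inE xS xD.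
(* Sets shattered by one half avoid [x]. A set [S] shattered by both halves counts twice in
   [#|S0| + #|S1|]; the set [x |: S], also shattered by [A], pays for the second time. *)
pose S2 := [set x |: S | S in S0 :&: S1].
have cS2 : #|S2| = #|S0 :&: S1|.
  rewrite card_in_imset // => S S'; rewrite !inE => /andP[hS _] /andP[hS' _] /setP e.
  apply/setP=> z; have := e z; rewrite !inE; case: (eqVneq z x) => // -> _.
  by rewrite (negPf (x0 S _)) ?inE // (negPf (x0 S' _)) ?inE.
have d2 : [disjoint S0 :|: S1 & S2].
  rewrite -setI_eq0; apply/eqP/setP=> S; rewrite in_setI in_set0; apply/negP => /andP[].
  move=> hS /imsetP[S' _ e]; move: hS; rewrite in_setU => /orP[/x0|/x1];
  by rewrite e !inE eqxx.
have sub : S0 :|: S1 :|: S2 \subset [set S | shatters A S].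
  apply/subsetP=> S; rewrite in_setU in_setU => /orP[/orP[]|]; rewrite ?[S \in S0]inE ?[S \in S1]inE.
  - by rewrite inE; apply: shatters_sub.
  - by rewrite inE; apply: shatters_sub.
  case/imsetP=> S'; rewrite in_setI => /andP[S'0 S'1] ->; rewrite inE.
  have xS' := x0 _ S'0; move: S'0 S'1; rewrite !inE => /shattersP k0 /shattersP k1.
  apply/shattersP=> U US.
  have US' : U :\ x \subset S' by rewrite subDset.
  case xU : (x \in U).
    have [D] := k1 _ US'; rewrite inE => /andP[DA xD] e; exists D => //.
    apply/setP=> z; have /setP/(_ z) := e; rewrite !inE; case: (eqVneq z x) => [->|//].
    by rewrite xU xD.
  have [D] := k0 _ US'; rewrite inE => /andP[DA xD] e; exists D => //.
  apply/setP=> z; have /setP/(_ z) := e; rewrite !inE; case: (eqVneq z x) => [->|//].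
  by rewrite xU (negPf xD).
have := subset_leq_card sub; rewrite cardsU (disjoint_setI0 d2) cards0 cS2 cardsU.
have : #|S0 :&: S1| <= #|S0| by rewrite subset_leq_card ?subsetIl.
lia.
Qed.

(** A set of at most [d] elements is read off a [d]-tuple of optional elements of [S], with [None]
    as padding. *)
Lemma card_small_subsets (T : finType) (S : {set T}) (d : nat) :
  #|[set U : {set T} | (U \subset S) && (#|U| <= d)]| <= #|S|.+1 ^ d.
Proof.
pose val_of (f : {ffun 'I_d -> option {x | x \in S}}) : {set T} :=
  [set x | [exists i, omap val (f i) == Some x]].
have -> : #|S|.+1 ^ d = #|{: {ffun 'I_d -> option {x | x \in S}}}|.
  by rewrite card_ffun card_option card_sig card_ord; congr (_.+1 ^ _); apply: eq_card.
apply: (leq_trans _ (leq_imset_card val_of _)); apply: subset_leq_card.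
apply/subsetP=> U; rewrite inE => /andP[US Ud]; apply/imsetP.
exists [ffun i : 'I_d => if insub (i : nat) is Some j then insub (enum_val (j : 'I_#|U|)) else None] => //.
apply/setP=> x; rewrite inE; apply/idP/existsP => [xU | [i]].
  have lt : enum_rank_in xU x < d by apply: leq_trans Ud.
  exists (Ordinal lt); rewrite ffunE valK insubT /=.
    by rewrite (subsetP US) // enum_valP.
  by move=> p; rewrite enum_rankK_in.
rewrite ffunE; case: insubP => //= j _ _; case: insubP => //= u _ e /eqP[<-].
by rewrite e; apply: enum_valP.
Qed.

Lemma sauer_shelah (T : finType) (A : {set {set T}}) (S0 : {set T}) (d : nat) :
  (forall B, B \in A -> B \subset S0) ->
  (forall S, shatters A S -> #|S| <= d) -> #|A| <= #|S0|.+1 ^ d.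
Proof.
move=> AS hd; apply: (leq_trans (card_shatters A)).
apply: (leq_trans _ (card_small_subsets S0 d)); apply: subset_leq_card.
apply/subsetP=> S; rewrite !inE => hS; rewrite hd // andbT.
have [B BA ->] := shattersP _ _ hS _ (subxx S).
by apply: subset_trans (AS _ BA); apply: subsetIl.
Qed.

Lemma inj_into (P T : finType) (A : {set T}) :
  #|P| <= #|A| -> exists2 f : P -> T, injective f & forall p, f p \in A.
Proof.
move=> PA; exists (fun p => enum_val (widen_ord PA (enum_rank p))).
  by move=> p q /enum_val_inj /(congr1 val) /= /ord_inj /enum_rank_inj.
by move=> p; apply: enum_valP.
Qed.

Lemma card_bigcup_le (I T : finType) (P : pred I) (F : I -> {set T}) :
  #|\bigcup_(i | P i) F i| <= \sum_(i | P i) #|F i|.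
Proof.
elim/big_rec2: _ => [|i n A _ h]; first by rewrite cards0.
by rewrite cardsU (leq_trans (leq_subr _ _)) // leq_add2l.
Qed.

Lemma leq_exp2rW (m n e : nat) : m <= n -> m ^ e <= n ^ e.
Proof. by case: e => // e mn; rewrite leq_exp2r. Qed.

(* X consists of the (d+1)-tuples over Y and E is membership: by Sauer-Shelah, many tuples have the
   same neighbourhood in E', which is then large. *)
Lemma bipartite_ramsey (P : finType) (d : nat) :
  exists (X Y : finType) (E : X -> Y -> bool), forall E' : X -> Y -> bool,
    (forall x y, E x y -> E' x y) ->
    (forall S, shatters [set [set y | E' x y] | x : X] S -> #|S| <= d) ->
    exists (a : P -> X) (b : P -> Y),
      [/\ injective a, injective b & forall p q, ~~ E (a p) (b q) && E' (a p) (b q)].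
Proof.
(* [N] gives [N.+1 ^ d * c ^ d.+1 < N ^ d.+1], so more than [c ^ d.+1] tuples share a trace. [c]
   leaves [m] points of that trace once the at most [m * d.+1] entries of [m] tuples are deleted. *)
set m := #|P|; pose c := m * d.+1 + m; pose N := (2 ^ d * c ^ d.+1).+1.
exists {ffun 'I_d.+1 -> 'I_N}, 'I_N, (fun (x : {ffun 'I_d.+1 -> 'I_N}) y => y \in codom x) => E' EE' hd.
pose tr x : {set 'I_N} := [set y | E' x y].
have ctr : #|[set tr x | x : {ffun 'I_d.+1 -> 'I_N}]| <= N.+1 ^ d.
  have := @sauer_shelah _ [set tr x | x : {ffun 'I_d.+1 -> 'I_N}] setT d.
  by rewrite cardsT card_ord; apply => // B _; apply: subsetT.
pose fib z := [set x | tr x == z].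
have [z zc] : exists z, c ^ d.+1 < #|fib z|.
  apply/existsP; rewrite -[[exists _, _]]negbK negb_exists; apply/negP => /forallP h.
  have : #|{ffun 'I_d.+1 -> 'I_N}| <= N.+1 ^ d * c ^ d.+1.
    rewrite -sum1_card (partition_big_imset tr) /=.
    apply: (@leq_trans (\sum_(z in [set tr x | x : {ffun 'I_d.+1 -> 'I_N}]) c ^ d.+1)).
      apply: leq_sum => z _; rewrite sum1dep_card; have := h z; rewrite -leqNgt.
      by apply: leq_trans; rewrite subset_leq_card //; apply/subsetP=> x; rewrite !inE.
    by rewrite sum_nat_const leq_mul2r ctr orbT.
  rewrite card_ffun !card_ord; apply/negP; rewrite -ltnNge.
  apply: (@leq_ltn_trans ((2 * N) ^ d * c ^ d.+1)).
    by rewrite leq_mul2r; apply/orP; right; apply: leq_exp2rW; rewrite mul2n -addnn; lia.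
  by rewrite expnMn [2 ^ d * _]mulnC -mulnA [N ^ d.+1]expnSr ltn_pmul2l ?expn_gt0.
(* As [E'] extends [E], every tuple with trace [z] has its entries in [z], so there are at most
   [#|z| ^ d.+1] of them. *)
have cz : c < #|z|.
  rewrite ltnNge; apply/negP => h; move: zc; apply/negP; rewrite -leqNgt.
  apply: (@leq_trans #|ffun_on (mem z) : pred {ffun 'I_d.+1 -> 'I_N}|).
    apply: subset_leq_card; apply/subsetP => x; rewrite inE => /eqP xz.
    apply/ffun_onP => i; rewrite -xz inE; apply: EE'; apply: codom_f.
  by rewrite card_ffun_on card_ord; apply: leq_exp2rW.
have mf : #|P| <= #|fib z|.
  apply: leq_trans (ltnW zc); apply: (@leq_trans (c ^ 1)); first by rewrite expn1 leq_addl.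
  by rewrite expn1 /c; case: (posnP m) => [->//|m0]; rewrite -{1}[_ + _]expn1 leq_pexp2l //; lia.
have [a ai az] := inj_into mf.
(* A point of [z] outside [W] is an entry of no chosen tuple: it is joined to all of them by [E']
   and to none by [E]. *)
pose W := \bigcup_(p : P) [set y in codom (a p)].
have cW : #|W| <= m * d.+1.
  rewrite /m -sum_nat_const; apply: (leq_trans (card_bigcup_le _ _)); apply: leq_sum => p _.
  rewrite cardsE; apply: (leq_trans (card_size _)).
  by rewrite size_codom card_ord.
have mW : #|P| <= #|z :\: W|.
  rewrite -(leq_add2l #|z :&: W|) cardsID.
  apply: (leq_trans _ (ltnW cz)); rewrite leq_add2r (leq_trans _ cW) //.
  by rewrite subset_leq_card ?subsetIr.
have [b bi bz] := inj_into mW.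
exists a, b; split=> // p q; have := bz q; rewrite inE => /andP[bW bz'].
apply/andP; split.
  by apply: contra bW => h; apply/bigcupP; exists p; rewrite ?inE.
by have := az p; rewrite inE => /eqP e; move: bz'; rewrite -e inE.
Qed.

(** * Epsilon-nets by double sampling *)

Lemma leq_expB_half (e N A : nat) : 0 < e -> A <= N -> N <= e * A ->
  2 * (N - A) ^ e <= N ^ e.
Proof.
case: e => // e _ AN NA; rewrite -{2}(subnK AN); set B := N - A.
have BA : B <= e.+1 * A by rewrite (leq_trans _ NA) // leq_subr.
(* Bernoulli's inequality; by [BA] its second term is at least the first when [k] is [e]. *)
suff h k : B ^ k.+1 + k.+1 * A * B ^ k <= (B + A) ^ k.+1.
  apply: leq_trans (h e); rewrite mul2n -addnn leq_add2l expnS.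
  by rewrite leq_mul2r BA orbT.
elim: k => [|k IH]; first by rewrite expn0 muln1 mul1n; apply: leqnn.
rewrite [(B + A) ^ _]expnS; apply: (leq_trans _ (leq_mul (leqnn _) IH)).
rewrite !expnS; set X := B ^ k; nia.
Qed.

(** Taking [t] to be a power of two bounds the left side by a power of two with exponent linear in
    [D], against [2 ^ (D + D)] on the right. A double sample will have a constant times [t * t]
    points, so this [t] beats the polynomial bound on its traces. *)
Lemma poly_lt_exp2 (c d : nat) : exists t, 2 * (c * (t * t)).+1 ^ d < 2 ^ t.
Proof.
pose D := 4 * d + d * c + d + 2; exists (2 ^ (D + D)).
have h : (c * (2 ^ (D + D) * 2 ^ (D + D))).+1 <= 2 ^ (c + 4 * D + 1).
  rewrite -expnD (_ : D + D + (D + D) = 4 * D); last by lia.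
  rewrite !expnD; have := ltn_expl c (ltnSn 1); have : 0 < 2 ^ (4 * D) by rewrite expn_gt0.
  rewrite -[2 ^ 1]/2; set u := 2 ^ (4 * D); set v := 2 ^ c; nia.
apply: (@leq_ltn_trans (2 ^ (1 + (c + 4 * D + 1) * d))).
  by rewrite [X in _ <= X]expnD leq_mul2l /= expnM; apply: leq_exp2rW.
rewrite ltn_exp2l // expnD; have := ltn_expl D (ltnSn 1); set u := 2 ^ D => uD.
apply: (@leq_trans (D.+1 * D.+1)); last by apply: leq_mul.
by rewrite /D; nia.
Qed.

(* Double sampling: [z] consists of two samples, indexed by the Boolean component; [swap] exchanges
   the two sample points at the indices where [s] is true. *)
Lemma eps_net_exists (I O : finType) (A : I -> {set O}) (t l p : nat) :
  0 < #|O| ->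
  (forall i, 2 * t * #|~: A i| ^ l <= #|O| ^ l) ->
  (forall z : {ffun 'I_t * 'I_l * bool -> O}, #|[set [set j | z j \in A i] | i : I]| <= p) ->
  2 * p < 2 ^ t ->
  exists x : {ffun 'I_t * 'I_l -> O}, forall i, exists j, x j \in A i.
Proof.
move=> O0 hA hp pt; set J := ('I_t * 'I_l)%type.
suff /existsP[x /forallP h] : [exists x : {ffun J -> O}, forall i, [exists j, x j \in A i]].
  by exists x => i; apply/existsP.
rewrite -[[exists _, _]]negbK negb_exists; apply/negP => /forallP nx.
have {}nx (x : {ffun J -> O}) : exists i, [forall j, x j \notin A i].
  have := nx x; rewrite negb_forall => /existsP[i]; rewrite negb_exists => hi.
  by exists i.
(* A sample is cut into [t] blocks of [l] points. Each block that is hit will later fix one bit of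
   the swap, which is the source of the factor [2 ^ t]. *)
pose hit i (y : {ffun J -> O}) := [forall a : 'I_t, [exists b : 'I_l, y (a, b) \in A i]].
pose fst_ (z : {ffun J * bool -> O}) : {ffun J -> O} := [ffun j => z (j, false)].
pose snd_ (z : {ffun J * bool -> O}) : {ffun J -> O} := [ffun j => z (j, true)].
pose Q := [set z | [exists i, [forall j, fst_ z j \notin A i] && hit i (snd_ z)]].
(* Without a net, every first sample misses some [A i]; a union bound over the [t] blocks shows that
   at least half of the second samples hit this [A i] in all blocks. *)
have lower : #|{ffun J * bool -> O}| <= 2 * #|Q|.
  have hith i : #|{ffun J -> O}| <= 2 * #|[set y | hit i y]|.
    have c1 := cardsC [set y | hit i y].
    suff : 2 * #|~: [set y | hit i y]| <= #|{ffun J -> O}|.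
      by rewrite -c1; set u := #|[set y | _]|; set v := #|~: _|; lia.
    have sub : ~: [set y | hit i y] \subset
        \bigcup_(a : 'I_t) [set y in family (fun j : J => mem (if j.1 == a then ~: A i else setT))].
      apply/subsetP => y; rewrite !inE negb_forall => /existsP[a].
      rewrite negb_exists => /forallP h; apply/bigcupP; exists a => //; rewrite inE.
      by apply/familyP => -[a' b] /=; case: eqP => [->|_]; rewrite !inE.
    have := leq_trans (subset_leq_card sub) (card_bigcup_le _ _).
    have -> : \sum_(a : 'I_t) #|[set y in family (fun j : J => mem (if j.1 == a then ~: A i else setT))]|
      = \sum_(a : 'I_t) #|~: A i| ^ l * #|O| ^ (l * t.-1).
      apply: eq_bigr => a _; rewrite cardsE card_family /image_mem foldrE big_map.
      rewrite big_enum /= -(pair_bigA _ (fun a' b => #|mem (if a' == a then ~: A i else setT)|)) /=.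
      rewrite (bigD1 a) //= eqxx prod_nat_const card_ord; congr (_ * _).
      rewrite (eq_bigr (fun _ => #|O| ^ l)); last first.
        by move=> a' /negPf ->; rewrite prod_nat_const card_ord cardsT.
      by rewrite prod_nat_const -expnM; congr (_ ^ (_ * _)); have := cardC1 a; rewrite card_ord.
    rewrite sum_nat_const card_ord => h; apply: (leq_trans (leq_mul (leqnn 2) h)).
    rewrite !mulnA; have [t0|t0] := posnP t; first by rewrite [X in 2 * X * _]t0 muln0.
    apply: (leq_trans (leq_mul (hA i) (leqnn _))); rewrite -expnD card_ffun card_prod !card_ord.
    by rewrite -mulnS prednK // mulnC.
  have -> : #|{ffun J * bool -> O}| = \sum_(x : {ffun J -> O}) #|{ffun J -> O}|.
    by rewrite sum_nat_const !card_ffun !card_prod card_bool -expnD addnn muln2.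
  pose ch x := xchoose (nx x).
  apply: (@leq_trans (\sum_x 2 * #|[set y | hit (ch x) y]|)); first by apply: leq_sum.
  rewrite -big_distrr leq_mul2l /=.
  under eq_bigr => x _ do rewrite -sum1dep_card.
  rewrite (pair_big_dep xpredT (fun x y => hit (ch x) y) (fun _ _ => 1)) sum1dep_card.
  pose join (xy : {ffun J -> O} * {ffun J -> O}) : {ffun J * bool -> O} :=
    [ffun j => if j.2 then xy.2 j.1 else xy.1 j.1].
  have fj xy : fst_ (join xy) = xy.1 by apply/ffunP => j; rewrite !ffunE.
  have sj xy : snd_ (join xy) = xy.2 by apply/ffunP => j; rewrite !ffunE.
  have joinI : injective join.
    by apply: (can_inj (g := fun z => (fst_ z, snd_ z))) => -[x y]; rewrite fj sj.
  rewrite -(card_imset _ joinI).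
  apply: subset_leq_card; apply/subsetP=> z /imsetP[[x y]]; rewrite inE /= => h ->.
  rewrite inE; apply/existsP; exists (ch x); rewrite sj h andbT fj.
  exact: (xchooseP (nx x)).
pose swap (s : {ffun J -> bool}) (z : {ffun J * bool -> O}) : {ffun J * bool -> O} :=
  [ffun j => z (j.1, j.2 (+) s j.1)].
have swapK s : involutive (swap s).
  by move=> z; apply/ffunP => -[j b]; rewrite !ffunE /= addbK.
(* Each [swap s] permutes the double samples, so [Q] may be counted by fixing [z] and counting the
   swaps that bring it into [Q]: for each of the at most [p] traces, a proportion of at most
   [1 / 2 ^ t]. *)
have upper : #|Q| * #|{ffun J -> bool}| * 2 ^ t <= #|{ffun J * bool -> O}| * p * #|{ffun J -> bool}|.
  have -> : #|Q| * #|{ffun J -> bool}| = \sum_(z : {ffun J * bool -> O}) #|[set s | swap s z \in Q]|.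
    rewrite mulnC -sum_nat_const.
    under [RHS]eq_bigr => z _ do rewrite -sum1dep_card big_mkcond.
    rewrite exchange_big; apply: eq_bigr => s _ /=; rewrite -big_mkcond sum1dep_card.
    rewrite -[LHS](card_imset _ (inv_inj (swapK s))); apply: eq_card => z.
    apply/imsetP/idP => [[z' z'Q ->]|]; rewrite inE ?swapK // => zQ.
    by exists (swap s z); rewrite ?swapK.
  rewrite big_distrl -mulnA -sum_nat_const; apply: leq_sum => z _ /=.
  pose traces := [set [set j | z j \in A i] | i : I].
  pose compat (B : {set J * bool}) := [set s : {ffun J -> bool} |
     [forall j, (j, s j) \notin B] &&
     [forall a, [exists b, ((a, b), ~~ s (a, b)) \in B]]].
  (* In each block, [B] forces one bit common to all compatible swaps. Flipping these [t] bits
     arbitrarily embeds the product of [compat B] with a [t]-cube into all swaps. *)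
  have hc B : #|compat B| * 2 ^ t <= #|{ffun J -> bool}|.
    have [->|[s0]] := set_0Vmem (compat B); first by rewrite cards0.
    rewrite inE => /andP[/forallP s01 /forallP s02].
    have {}s02 a : exists b, ((a, b), ~~ s0 (a, b)) \in B by apply/existsP.
    pose ch a := xchoose (s02 a).
    have hs s a : s \in compat B -> s (a, ch a) = s0 (a, ch a).
      rewrite inE => /andP[/forallP h _]; apply/eqP; rewrite -[_ == _]negbK.
      apply/negP => ne; have := xchooseP (s02 a); rewrite -/(ch a).
      by have := h (a, ch a); move: ne; case: (s _); case: (s0 _) => //= _ /negPf ->.
    have -> : 2 ^ t = #|[set: {ffun 'I_t -> bool}]| by rewrite cardsT card_ffun card_ord card_bool.
    rewrite -cardsX.
    pose f (q : {ffun J -> bool} * {ffun 'I_t -> bool}) : {ffun J -> bool} :=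
      [ffun j => q.1 j (+) (q.2 j.1 && (j.2 == ch j.1))].
    rewrite -(@card_in_imset _ _ f) ?max_card //.
    move=> [s e] [s' e']; rewrite !in_setX /= => /andP[hs1 _] /andP[hs2 _] /ffunP ff.
    have ee : e = e'.
      apply/ffunP => a; have := ff (a, ch a); rewrite !ffunE /= eqxx !andbT.
      by rewrite !hs // => /addbI.
    by congr (_, _) => //; apply/ffunP => j; have := ff j; rewrite !ffunE ee => /addIb.
  have sub : [set s | swap s z \in Q] \subset \bigcup_(B in traces) compat B.
    apply/subsetP => s; rewrite !inE => /existsP[i /andP[/forallP h1 /forallP h2]].
    apply/bigcupP; exists [set j | z j \in A i]; first exact: imset_f.
    rewrite inE; apply/andP; split; apply/forallP.
      by move=> j; have := h1 j; rewrite !ffunE inE.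
    move=> a; have /existsP[b hb] := h2 a; apply/existsP; exists b.
    by move: hb; rewrite !ffunE inE.
  apply: (leq_trans (leq_mul (leq_trans (subset_leq_card sub) (card_bigcup_le _ _)) (leqnn _))).
  rewrite big_distrl /=; apply: (@leq_trans (\sum_(B in traces) #|{ffun J -> bool}|)).
    by apply: leq_sum => B _; apply: hc.
  by rewrite sum_nat_const leq_mul2r hp orbT.
have pos1 : 0 < #|{ffun J -> bool}| by rewrite card_ffun expn_gt0 card_bool.
have pos2 : 0 < #|{ffun J * bool -> O}| by rewrite card_ffun expn_gt0 O0.
move: lower upper pt pos1 pos2.
set z := #|{ffun J * bool -> O}|; set q := #|Q|; set w := #|{ffun J -> bool}|; set T := 2 ^ t.
clear; move=> lower upper pt pos1 pos2.
have : q * T <= z * p by nia.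
nia.
Qed.

(** Blocks of [e * t] points suffice: [e] random points miss a set of density at least [1 / e] with
    probability at most one half, so a block misses it with probability at most [1 / 2 ^ t], which
    is at most [1 / (2 * t)]. *)
Lemma eps_net_bounded (e c d : nat) : 0 < e -> exists K, forall (I O : finType) (A : I -> {set O}),
  0 < #|O| -> (forall i, #|O| <= e * #|A i|) ->
  (forall (J : finType) (z : {ffun J -> O}),
     #|[set [set j | z j \in A i] | i : I]| <= (c * #|J|).+1 ^ d) ->
  exists2 T : {set O}, #|T| <= K & forall i, exists2 o, o \in T & o \in A i.
Proof.
move=> e0; have [t ht] := poly_lt_exp2 (c * (e * 2)) d; exists (t * (e * t)) => I O A O0 hA hz.
pose J := ('I_t * 'I_(e * t) * bool)%type.
have cJ : c * #|{: J}| = c * (e * 2) * (t * t) by rewrite !card_prod !card_ord card_bool; lia.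
have hA' i : 2 * t * #|~: A i| ^ (e * t) <= #|O| ^ (e * t).
  have tt : 2 * t <= 2 ^ t by elim: t {ht J cJ} => // -[|t] //; rewrite [2 ^ t.+2]expnS; lia.
  apply: (leq_trans (leq_mul tt (leqnn _))); rewrite !expnM -expnMn; apply: leq_exp2rW.
  by rewrite -(cardsC (A i)) -{1}[#|~: A i|](addKn #|A i|) cardsC leq_expB_half ?max_card.
have ht' : 2 * (c * #|{: J}|).+1 ^ d < 2 ^ t by rewrite cJ.
have [x hx] := eps_net_exists O0 hA' (hz _) ht'.
exists [set x j | j in setT].
  by rewrite (leq_trans (leq_imset_card _ _)) // cardsT card_prod !card_ord.
by move=> i; have [j xj] := hx i; exists (x j); rewrite ?imset_f.
Qed.

(** * Graphs *)

Lemma pullback_sym (G : sgraph) (T : finType) (f : T -> G) :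
  symmetric (fun x y => adj (f x) (f y)).
Proof. by move=> x y; rewrite adj_sym. Qed.

Lemma pullback_irrefl (G : sgraph) (T : finType) (f : T -> G) :
  irreflexive (fun x y => adj (f x) (f y)).
Proof. by move=> x; rewrite adj_irrefl. Qed.

Definition pullback (G : sgraph) (T : finType) (f : T -> G) : sgraph :=
  SGraph (pullback_sym f) (pullback_irrefl f).

Definition induced (G : sgraph) (A : {set G}) : sgraph :=
  pullback (val : {x | x \in A} -> G).

(** Singleton traces force [f] to be injective on [S], so the image of [S] is shattered in [G]. This
    covers pullbacks and adjacency between two parts alike. *)
Lemma shatters_VC_dim (G : sgraph) (I T : finType) (h : I -> G) (f : T -> G) (S : {set T}) :
  shatters [set [set y | adj (h i) (f y)] | i : I] S -> #|S| <= VC_dim G.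
Proof.
move=> /shattersP hS.
have tr (U : {set T}) : U \subset S -> exists i, forall y, y \in S -> (y \in U) = adj (h i) (f y).
  move=> /hS[B /imsetP[i _ ->] e]; exists i => y yS.
  by move/setP/(_ y): e; rewrite !inE yS andbT.
have fi : {in S &, injective f}.
  move=> x y xS yS fxy; have [|i hi] := tr [set x]; first by rewrite sub1set.
  by have := hi y yS; rewrite -fxy -hi // !inE eqxx => /eqP.
rewrite -(card_in_imset fi) /VC_dim.
apply: (leq_bigmax_cond (P := fun S : {set G} => shattered S) (F := fun S : {set G} => #|S|)).
rewrite /shattered eqEsubset; apply/andP; split; apply/subsetP => U.
  by case/imsetP => v _ ->; rewrite powersetE subsetIr.
rewrite powersetE => US; have [|i hi] := tr [set y in S | f y \in U].
  by apply/subsetP => y; rewrite inE => /andP[].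
apply/imsetP; exists (h i) => //; apply/setP => z; rewrite !inE.
apply/idP/andP => [zU | [hz /imsetP[y yS zy]]].
  have /imsetP[y yS zy] := subsetP US _ zU; split; last by rewrite zy imset_f.
  by rewrite zy -hi // inE yS -zy.
by move: hz; rewrite zy -hi // inE yS.
Qed.

Lemma VC_dim_pullback (G : sgraph) (T : finType) (f : T -> G) :
  VC_dim (pullback f) <= VC_dim G.
Proof.
apply/bigmax_leqP => S /eqP hS; apply: (shatters_VC_dim (h := f) (f := f)).
apply/shattersP => U; rewrite -powersetE -hS => /imsetP[v _ ->].
by exists (nbhd v); rewrite // imset_f.
Qed.

(** The [1] accounts for the graph without vertices, where no set is shattered and the maximum has
    its default value 0. *)
Lemma VC_dim_exp (G : sgraph) : 2 ^ VC_dim G <= maxn 1 #|G|.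
Proof.
rewrite /VC_dim; elim/big_ind: _ => [|m n hm hn|S /eqP hS].
- by rewrite expn0 leq_maxl.
- by rewrite /maxn; case: ifP.
by rewrite leq_max -card_powerset -hS leq_imset_card orbT.
Qed.

Lemma colorableP (G : sgraph) (k : nat) :
  reflect (exists c : G -> 'I_k, forall x y, adj x y -> c x != c y) (colorable G k).
Proof.
apply: (iffP existsP) => -[c hc].
  by exists c => x y xy; move/forallP/(_ x)/forallP/(_ y)/implyP: hc; apply.
exists (finfun c); apply/forallP => x; apply/forallP => y; apply/implyP => xy.
by rewrite !ffunE hc.
Qed.

Lemma chromatic_number_leP (G : sgraph) (k : nat) :
  reflect (colorable G k) (chromatic_number G <= k).
Proof.
rewrite /chromatic_number; case: ex_minnP => m hm hmin.
apply: (iffP idP) => [mk|]; last exact: hmin.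
have /colorableP[c hc] := hm; apply/colorableP; exists (fun x => widen_ord mk (c x)) => x y xy.
by apply: contra (hc _ _ xy) => /eqP/(congr1 val)/=/ord_inj/eqP.
Qed.

Lemma colorable_hom (G K : sgraph) (f : G -> K) (k : nat) :
  (forall x y, adj x y -> adj (f x) (f y)) -> colorable K k -> colorable G k.
Proof.
move=> fe /colorableP[c hc]; apply/colorableP; exists (c \o f) => x y /fe.
exact: hc.
Qed.

Lemma min_degree_le (G : sgraph) (v : G) : min_degree G <= degree v.
Proof.
rewrite /min_degree; have := mem_index_enum v; elim: (index_enum G) => // u s IH.
rewrite big_cons in_cons => /orP[/eqP <-|/IH]; first exact: geq_minl.
exact: leq_trans (geq_minr _ _).
Qed.

Lemma min_degree_ge (G : sgraph) (m : nat) :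
  m <= #|G| -> (forall v : G, m <= degree v) -> m <= min_degree G.
Proof.
move=> mG h; rewrite /min_degree; elim/big_ind: _ => // a b ma mb.
by rewrite leq_min ma.
Qed.

Lemma min_degree_card (G : sgraph) : min_degree G <= #|G|.
Proof.
rewrite /min_degree; elim/big_rec: _ => // v n _ nG.
by rewrite geq_min nG orbT.
Qed.

Lemma min_degree_subrel (G : sgraph) (e : rel G) (es : symmetric e) (ei : irreflexive e) :
  subrel (@adj G) e -> min_degree G <= min_degree (SGraph es ei).
Proof.
move=> se; apply: min_degree_ge; first exact: min_degree_card.
move=> v; apply: (leq_trans (min_degree_le (v : G))); apply: subset_leq_card.
by apply/subsetP => u; rewrite !inE; apply: se.
Qed.

(** Edges are added while [H] is avoided; the number of non-edges decreases. The result is a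
    relation on the vertices of [G], so that cardinalities and vertices are shared without
    transport. *)
Lemma maximal_free_extension (H G : sgraph) : Defs.free H G ->
  exists (e : rel G) (es : symmetric e) (ei : irreflexive e),
    subrel (@adj G) e /\ maximal_free H (SGraph es ei).
Proof.
pose nonedges (K : sgraph) := #|[set p : K * K | ~~ adj p.1 p.2]|.
have [n] := ubnP (nonedges G); elim: n G => // n IH G nG GH.
have [[u [v [uv nuv fuv]]]|h] :=
  pselect (exists u v : G, [/\ u != v, ~~ adj u v & Defs.free H (add_edge u v)]); last first.
  exists (@adj G), (@adj_sym G), (@adj_irrefl G); split=> //; split=> //.
  move=> u v uv nuv; apply: contrapT => k; apply: h; by exists u, v.
have sub : subrel (@adj G) (@adj (add_edge u v)) by move=> x y xy; rewrite /= /add_edge_rel xy.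
have [|e [es [ei [se me]]]] := IH (add_edge u v) _ fuv.
  rewrite -ltnS; apply: leq_trans nG; rewrite ltnS; apply: proper_card; apply/properP; split.
    by apply/subsetP => p; rewrite !inE; apply: contra; apply: sub.
  by exists (u, v); rewrite !inE //= /add_edge_rel uv eqxx orbT.
by exists e, es, ei; split=> // x y /sub /se.
Qed.

(** * Complete multipartite graphs with a graph inserted into one part *)

Definition multipartite_rel (L : sgraph) (k : nat) : rel ('I_k.+1 * L) :=
  fun x y => (x.1 != y.1) || (x.1 == ord0) && adj x.2 y.2.

Lemma multipartite_sym (L : sgraph) (k : nat) : symmetric (@multipartite_rel L k).
Proof.
move=> [i x] [j y]; rewrite /multipartite_rel /= eq_sym adj_sym.
by case: eqVneq => //= ->.
Qed.

Lemma multipartite_irrefl (L : sgraph) (k : nat) : irreflexive (@multipartite_rel L k).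
Proof. by move=> x; rewrite /multipartite_rel eqxx adj_irrefl andbF. Qed.

Definition multipartite (L : sgraph) (k : nat) : sgraph :=
  SGraph (@multipartite_sym L k) (@multipartite_irrefl L k).

Lemma card_multipartite (L : sgraph) (k : nat) : #|multipartite L k| = k.+1 * #|L|.
Proof. by rewrite card_prod card_ord. Qed.

Lemma min_degree_multipartite (L : sgraph) (k : nat) : k * #|L| <= min_degree (multipartite L k).
Proof.
apply: min_degree_ge; first by rewrite card_multipartite leq_mul2r leqnSn orbT.
move=> [i x]; have -> : k * #|L| = #|setX [set~ i] [set: L]|.
  by rewrite cardsX cardsT cardsC1 card_ord.
apply: subset_leq_card; apply/subsetP => -[j y]; rewrite !inE andbT => ji.
by rewrite /= /multipartite_rel /= eq_sym ji.
Qed.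

(** Encodes the removal of [k] disjoint, possibly empty, independent sets: the classes of [rho]
    other than [ord0]. What remains is [core rho]. *)
Definition independent_off_0 (H : sgraph) (k : nat) (rho : H -> 'I_k.+1) : Prop :=
  forall x y, adj x y -> rho x = rho y -> rho x = ord0.

Definition core (H : sgraph) (k : nat) (rho : H -> 'I_k.+1) : sgraph :=
  induced [set x | rho x == ord0].

(** The part into which each vertex is embedded serves as [rho], since only part [ord0] has inner
    edges. *)
Lemma contains_multipartite (H L : sgraph) (k : nat) : contains H (multipartite L k) ->
  exists2 rho : H -> 'I_k.+1, independent_off_0 rho & contains (core rho) L.
Proof.
move=> [f [fi fe]]; exists (fun x => (f x).1).
  by move=> x y /fe; rewrite /= /multipartite_rel => + e; rewrite e eqxx => /andP[/eqP].
have zero (x : core (fun x => (f x).1)) : (f (val x)).1 = ord0.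
  by have := valP x; rewrite inE => /eqP.
exists (fun x => (f (val x)).2); split.
  move=> x y exy; apply: val_inj; apply: fi; apply: injective_projections => //.
  by rewrite !zero.
move=> x y /fe; rewrite /= /multipartite_rel.
by have := zero x; have := zero y => /= -> ->; rewrite eqxx.
Qed.

(** * Odd cycles *)

Lemma closed_path_cycle (T : eqType) (e : rel T) (x : T) (p : seq T) :
  p != [::] -> path e x p -> last x p = x -> exists2 c, cycle e c & size c = size p.
Proof.
case/lastP: p => // p y _ pp; rewrite last_rcons => yx; exists (x :: p).
  by rewrite /= -{2}yx.
by rewrite size_rcons.
Qed.

(** [cycle] allows repeated vertices, so cycles are closed walks throughout. A vertex is coloured by
    whether an odd walk reaches it from the root of its component: two odd walks to the ends of an
    edge would close up to an odd walk, and an even walk to one end extends to an odd walk to the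
    other. *)
Lemma colorable2_of_no_odd_cycle (G : sgraph) :
  (forall c : seq G, cycle (@adj G) c -> ~~ odd (size c)) -> colorable G 2.
Proof.
move=> no; pose e := @adj G; have cs : connect_sym e by apply: sym_connect_sym; apply: adj_sym.
pose oddw x := `[< exists p, [/\ path e (fingraph.root e x) p, last (fingraph.root e x) p = x & odd (size p)] >].
apply/colorableP; exists (fun x => if oddw x then ord0 else ord_max) => x y xy.
have rxy : fingraph.root e x = fingraph.root e y by apply/(fingraph.rootP cs)/connect1.
suff : oddw x != oddw y by case: (oddw x); case: (oddw y).
apply/negP => /eqP oxy; case ox : (oddw x) oxy => /esym oy.
  move/asboolP: ox => [p [pp lp op]]; move/asboolP: oy; rewrite -rxy => -[q [pq lq oq]].
  have [|||c /no + sc] := @closed_path_cycle _ e (fingraph.root e x) (p ++ y :: rev (belast (fingraph.root e x) q)).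
  - by case: (p).
  - rewrite cat_path pp lp /= [e x y]xy /=; move: pq; rewrite -lq rev_path.
    by congr is_true; apply: eq_path => a b; rewrite /e adj_sym.
  - by rewrite last_cat /=; case: (q) oq => //= a s _; rewrite rev_cons last_rcons.
  by rewrite sc size_cat /= size_rev size_belast oddD /= op oq.
have /connectP[p pp lp] : connect e (fingraph.root e x) x by rewrite cs connect_root.
case op : (odd (size p)).
  by move/negP: ox; apply; apply/asboolP; exists p.
move/negP: oy; apply; apply/asboolP; exists (rcons p y); rewrite -rxy rcons_path last_rcons size_rcons /= op.
by split=> //; rewrite pp -lp.
Qed.

Section ShortestOddCycle.

Variables (F : sgraph) (g : nat).
Hypothesis g_min : forall c : seq F, cycle (@adj F) c -> odd (size c) -> g <= size c.

(** A repeated vertex splits the closed walk into two shorter ones, one of them odd. *)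
Lemma shortest_odd_cycle_uniq (c : seq F) :
  cycle (@adj F) c -> size c = g -> odd g -> uniq c.
Proof.
move=> cc sc og; apply/negPn/negP => nu.
have [x [s1 [s2 [s3 e]]]] : exists x s1 s2 s3, c = s1 ++ x :: s2 ++ x :: s3.
  elim: c nu {cc sc} => //= a s IH; rewrite negb_and negbK => /orP[/splitPr[p1 p2]|/IH].
    by exists a, [::], p1, p2.
  by move=> [x [s1 [s2 [s3 ->]]]]; exists x, (a :: s1), s2, s3.
pose t := s3 ++ s1.
have e' : rot (size s1) c = x :: s2 ++ x :: t by rewrite e rot_size_cat /= -catA.
move: cc; rewrite -(rot_cycle (size s1)) e' /= rcons_cat cat_path /= => /and3P[p2 l2 pt].
have c2 : cycle (@adj F) (x :: s2) by rewrite /= rcons_path p2.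
have st : size (x :: s2) + size (x :: t) = g by rewrite -sc -(size_rot (size s1) c) e' /= size_cat.
have := g_min c2; have := g_min (c := x :: t) pt; move: st og => /=; clear; lia.
Qed.

(** The edge [x y] splits the closed walk into two of total length [g + 2]. One is odd, and it is
    shorter than [g] if both have length at least 3. *)
Lemma shortest_odd_cycle_chord (x y : F) (p1 p2 : seq F) :
  cycle (@adj F) (x :: p1 ++ y :: p2) -> size (x :: p1 ++ y :: p2) = g -> odd g -> adj x y ->
  p1 = [::] \/ p2 = [::].
Proof.
rewrite /= rcons_cat cat_path /= rcons_path => /and4P[h1 h2 h3 h4] sz og xy.
have c1 : cycle (@adj F) (x :: rcons p1 y).
  by rewrite /= rcons_path last_rcons rcons_path h1 h2 adj_sym xy.
have c2 : cycle (@adj F) (y :: rcons p2 x).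
  by rewrite /= rcons_path last_rcons rcons_path h3 h4 xy.
have := g_min c1; have := g_min c2; move: sz og; rewrite /= !size_cat !size_rcons /=.
case: p1 {h1 h2 c1} => [|? ?]; first by left.
case: p2 {h3 h4 c2} => [|? ?]; first by right.
rewrite /=; lia.
Qed.

(** By chordlessness, [x] and [y] are consecutive if both lie on the cycle. A rotation then confines
    them to the first two places. *)
Lemma shortest_odd_cycle_rot (c : seq F) (x y : F) :
  cycle (@adj F) c -> size c = g -> odd g -> adj x y ->
  exists i a b w, [/\ rot i c = [:: a, b & w], w != [::] & {in w, forall z, (z != x) && (z != y)}].
Proof.
have size3 (d : seq F) : cycle (@adj F) d -> size d = g -> odd g -> exists a b w, d = [:: a, b & w] /\ w != [::].
  case: d => [|a [|b [|z w]]] /= h <- //; last by move=> _; exists a, b, (z :: w).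
  by move: h; rewrite adj_irrefl.
wlog : x y / x \in c \/ (x \notin c /\ y \notin c).
  move=> wl cc sc og xy; have [xc|xc] := boolP (x \in c); first by apply: wl => //; left.
  have [yc|yc] := boolP (y \in c); last by apply: wl => //; right.
  have [|i [a [b [w [h1 h2 h3]]]]] := wl y x (or_introl yc) cc sc og; first by rewrite adj_sym.
  by exists i, a, b, w; split=> // z /h3; rewrite andbC.
move=> [xc|[xc yc]] cc sc og xy; last first.
  have [a [b [w [e w0]]]] := size3 c cc sc og; exists 0, a, b, w; rewrite rot0; split=> // z zw.
  have zc : z \in c by rewrite e !inE zw !orbT.
  by apply/andP; split; apply: contraTneq zc => ->.
have [i p e] := rot_to xc.
have ce : cycle (@adj F) (x :: p) by rewrite -e rot_cycle.
have se : size (x :: p) = g by rewrite -e size_rot.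
have ue := shortest_odd_cycle_uniq ce se og.
have [yp|yp] := boolP (y \in p); last first.
  have [a [b [w [[_ e'] w0]]]] := size3 _ ce se og; exists i, x, b, w; split=> //; first by rewrite e e'.
  move=> z zw; apply/andP; split.
    by apply: contraTneq zw => ->; move: ue; rewrite e' /= inE negb_or => /andP[/andP[]].
  by apply: contraNneq yp => <-; rewrite e' inE zw orbT.
move: e ce se ue; case/splitPr: yp => p1 p2 e ce se ue.
have [h|h] := shortest_odd_cycle_chord ce se og xy; rewrite {}h in e ce se ue *.
  exists i, x, y, p2; split=> //.
    by have [? [? [? [[_ _ ->]]]]] := size3 _ ce se og.
  move=> z zw; apply/andP; split; apply: contraTneq zw => ->; move: ue; rewrite /= inE negb_or.
    by case/andP => /andP[].
  by case/and3P.
have e2 : rot (size (x :: p1)) (rot i c) = [:: y, x & p1] by rewrite e -cat_cons rot_size_cat.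
have [j jj] : exists j, rot (size (x :: p1)) (rot i c) = rot j c.
  by exists (rot_add c i (size (x :: p1))); rewrite rot_rot_add.
exists j, y, x, p1; rewrite -jj; split=> //.
  have c2 : cycle (@adj F) [:: y, x & p1] by rewrite -e2 !rot_cycle.
  have s2 : size [:: y, x & p1] = g by rewrite -e2 !size_rot.
  by have [? [? [? [[_ _ ->]]]]] := size3 _ c2 s2 og.
move=> z zw; move: ue; rewrite /= cat_uniq mem_cat negb_or /= orbF => /andP[/andP[xp _] /and3P[_ yp _]].
by apply/andP; split; apply: contraTneq zw => ->.
Qed.

End ShortestOddCycle.

(** * Partite amalgamation over one edge *)

Section PartiteAmalgam.

Variables (F P : sgraph) (pi : P -> F) (x y : F) (X Y : finType) (E : X -> Y -> bool).

Definition copy : Type := {ffun P -> X} * {ffun P -> Y}.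

HB.instance Definition _ := Finite.on copy.

Definition amalgam : Type := (X + Y) + copy * P.

HB.instance Definition _ := Finite.on amalgam.

Definition inX (a : X) : amalgam := inl (inl a).
Definition inY (b : Y) : amalgam := inl (inr b).

(* The copies of P are glued only along the fibres of pi over x and y, which go to X and Y. *)
Definition copy_map (c : copy) (p : P) : amalgam :=
  if pi p == x then inX (c.1 p) else if pi p == y then inY (c.2 p) else inr (c, p).

(** The last condition keeps edges of [E] from joining two vertices of one glued copy;
    [bipartite_ramsey] supplies exactly such pairs of maps. *)
Definition admissible (c : copy) : bool :=
  [&& injectiveb c.1, injectiveb c.2 & [forall p, forall q, ~~ E (c.1 p) (c.2 q)]].

Definition copy_rel (c : copy) : rel amalgam :=
  fun u v => [exists p, exists q, [&& adj p q, u == copy_map c p & v == copy_map c q]].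

Definition base_rel : rel amalgam :=
  fun u v => match u, v with inl (inl a), inl (inr b) => E a b | _, _ => false end.

Definition amalgam_rel : rel amalgam :=
  fun u v => [|| base_rel u v, base_rel v u | [exists c, admissible c && copy_rel c u v]].

Definition amalgam_proj (u : amalgam) : F :=
  match u with inl (inl _) => x | inl (inr _) => y | inr (_, p) => pi p end.

Hypothesis pi_hom : forall p q, adj p q -> adj (pi p) (pi q).
Hypothesis pi_xy : forall p q, adj p q -> ~~ ((pi p == x) && (pi q == y)).

Lemma copy_rel_sym (c : copy) : symmetric (copy_rel c).
Proof.
by move=> u v; apply/existsP/existsP => -[p /existsP[q /and3P[pq up vq]]]; exists q; apply/existsP;
  exists p; rewrite adj_sym pq up vq.
Qed.

Lemma amalgam_sym : symmetric amalgam_rel.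
Proof.
move=> u v; rewrite /amalgam_rel; under eq_existsb => c do rewrite copy_rel_sym.
by rewrite !orbA [base_rel u v || _]orbC.
Qed.

Lemma copy_mapK (c : copy) (p : P) : amalgam_proj (copy_map c p) = pi p.
Proof. by rewrite /copy_map; case: eqP => [->|_] //; case: eqP => [->|]. Qed.

Lemma amalgam_irrefl : irreflexive amalgam_rel.
Proof.
move=> u; apply/negP => /or3P[||/existsP[c /andP[_ /existsP[p /existsP[q /and3P[pq /eqP up /eqP uq]]]]]].
- by case: u => [[]|].
- by case: u => [[]|].
by have := pi_hom pq; rewrite -(copy_mapK c) -up uq copy_mapK adj_irrefl.
Qed.

Definition amalgam_graph : sgraph := SGraph amalgam_sym amalgam_irrefl.

Lemma copy_map_inj (c : copy) : admissible c -> injective (copy_map c).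
Proof.
case/and3P => /injectiveP i1 /injectiveP i2 _ p q h.
have e : pi p = pi q by rewrite -(copy_mapK c p) h copy_mapK.
move: h; rewrite /copy_map e; case: ifP => _; first by case=> /i1.
by case: ifP => _; [case=> /i2 | case].
Qed.

(** A vertex outside [X] and [Y] belongs to a single copy, which therefore owns all edges at it. *)
Lemma amalgam_rel_private (c : copy) (p : P) (u : amalgam) :
  amalgam_rel u (inr (c, p)) -> copy_rel c u (inr (c, p)) && admissible c.
Proof.
case/or3P => [||/existsP[c' /andP[ac /existsP[p' /existsP[q /and3P[pq /eqP up /eqP vq]]]]]].
- by case: u => [[]|].
- by case: u => [[]|].
move: (vq); rewrite /copy_map; do 2 case: eqP => // _; case=> ec ep.
rewrite ec ac andbT; apply/existsP; exists p'; apply/existsP; exists q.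
by rewrite pq up -vq ec !eqxx.
Qed.

Variable g : nat.
Hypothesis g_odd : odd g.
Hypothesis g_min : forall c : seq F, cycle (@adj F) c -> odd (size c) -> g <= size c.
Hypothesis xy : adj x y.
Hypothesis P_cycle : forall c : seq P, cycle (@adj P) c -> size c != g.

Lemma amalgam_proj_hom (u v : amalgam) : amalgam_rel u v -> adj (amalgam_proj u) (amalgam_proj v).
Proof.
case/or3P => [||/existsP[c /andP[_ /existsP[p /existsP[q /and3P[pq /eqP-> /eqP->]]]]]].
- by case: u => [[]|] //; case: v => [[]|].
- by rewrite adj_sym; case: u => [[]|] //; case: v => [[]|].
by rewrite !copy_mapK pi_hom.
Qed.

Lemma copy_rel_cycle (c : copy) (s : seq amalgam) :
  admissible c -> s != [::] -> cycle (copy_rel c) s -> size s != g.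
Proof.
move=> /copy_map_inj ci; case: s => // u s _ cs.
have [p0 _] : exists p : P, True.
  by case: s cs => [|v s] /= /andP[/existsP[p _] _]; exists p.
pose back (v : amalgam) := odflt p0 [pick p | copy_map c p == v].
have backK p : back (copy_map c p) = p.
  by rewrite /back; case: pickP => [q /eqP/ci|/(_ p)/eqP].
have cb : cycle (@adj P) (map back (u :: s)).
  rewrite cycle_map; apply: sub_cycle cs => v w /existsP[p /existsP[q /and3P[pq /eqP-> /eqP->]]].
  by rewrite /= !backK.
by have := P_cycle cb; rewrite size_map.
Qed.

(* A cycle of length g projects to a shortest odd cycle of F, which is chordless: outside of two
   consecutive vertices it avoids X and Y, hence it stays in a single copy of P. *)
Lemma amalgam_cycle (s : seq amalgam_graph) : cycle (@adj amalgam_graph) s -> size s != g.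
Proof.
move=> cs; apply/negP => /eqP sg.
have cm : cycle (@adj F) (map amalgam_proj s).
  by rewrite cycle_map; apply: sub_cycle cs => u v; apply: amalgam_proj_hom.
have sm : size (map amalgam_proj s) = g by rewrite size_map.
have [i [a [b [w' [e w0 hw]]]]] := shortest_odd_cycle_rot g_min cm sm g_odd xy.
move: cs sg; rewrite -(rot_cycle i) -(size_rot i); rewrite -map_rot in e.
case: (rot i s) e => [|u [|v w]] //= [_ _ ew] cs sg.
have priv z : z \in w -> exists c p, z = inr (c, p).
  move=> zw; have := hw (amalgam_proj z); rewrite -ew map_f // => /(_ isT).
  by case: z {zw} => [[a'|b']|[c p]] /=; rewrite ?eqxx ?andbF //; exists c, p.
rewrite -{}ew in w0; move: cs; case: w w0 sg priv => [|z w] //= w0 sg priv.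
move=> /and3P[uv vz pw].
have [c [p ez]] := priv z (mem_head _ _).
have := amalgam_rel_private (eq_ind z (amalgam_rel v) vz _ ez); rewrite -ez => /andP[cvz ac].
(* Every vertex of [w] is private, so the copy [c] propagates along the cycle back to [u]. *)
have cw : path (copy_rel c) z (rcons w u).
  have {}priv z' : z' \in w -> exists c p, z' = inr (c, p).
    by move=> z'w; apply: priv; rewrite inE z'w orbT.
  elim: w z p ez pw priv {w0 sg vz cvz} => [|z' w IH] z p ez /= /andP[zz' pw] priv.
    rewrite ez amalgam_sym in zz'; rewrite copy_rel_sym andbT.
    by have /andP[+ _] := amalgam_rel_private zz'; rewrite -ez.
  rewrite ez amalgam_sym in zz'; have /andP[cz _] := amalgam_rel_private zz'.
  rewrite -ez copy_rel_sym in cz; rewrite cz /=.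
  have [c' [p' ez']] := priv z' (mem_head _ _).
  have ecc : c' = c.
    move: cz; rewrite ez ez' => /existsP[q /existsP[q' /and3P[_ _ ]]].
    by rewrite /copy_map; do 2 case: ifP => // _; case/eqP.
  rewrite ecc in ez'; apply: (IH z' p' ez' pw) => z'' z''w; by apply: priv; rewrite inE z''w orbT.
(* The edge [u v] is the only one left. Both ends lie in copy [c], so it is not from [E]; if it came
   from another copy, both ends would lie over [x] or [y], against [pi_xy] or irreflexivity. *)
suff cuv : copy_rel c u v.
  have := @copy_rel_cycle c [:: u, v, z & w] ac isT; rewrite /= cuv cvz cw => /(_ isT).
  by rewrite sg eqxx.
have [p1 eu] : exists p1, u = copy_map c p1.
  move: cw; rewrite rcons_path => /andP[_ /existsP[q /existsP[q' /and3P[_ _ /eqP]]]].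
  by exists q'.
have [q1 ev] : exists q1, v = copy_map c q1.
  by move: cvz => /existsP[q /existsP[q' /and3P[_ /eqP h _]]]; exists q.
have nE p' q' : ~~ E (c.1 p') (c.2 q').
  by case/and3P: ac => _ _ /forallP/(_ p')/forallP/(_ q').
have nb p' q' : ~~ base_rel (copy_map c p') (copy_map c q').
  by rewrite /copy_map; do 4 case: ifP => //= _.
case/or3P: (uv) => [h|h|/existsP[c' /andP[ac' cc']]].
- by move: h; rewrite eu ev (negPf (nb _ _)).
- by move: h; rewrite eu ev (negPf (nb _ _)).
have split p' : copy_map c p' = inr (c, p') \/ (pi p' == x) || (pi p' == y).
  by rewrite /copy_map; case: (pi p' == x); [right | case: (pi p' == y); [right | left]].
have privc u1 p' : copy_rel c' u1 (inr (c, p')) -> c' = c.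
  by move=> /existsP[q /existsP[q' /and3P[_ _ ]]]; rewrite /copy_map; do 2 case: ifP => // _; case/eqP.
have [h|h1] := split q1; first by rewrite -(privc u q1) // -h -ev.
have [h|h2] := split p1; first by rewrite -(privc v p1) // -h -eu copy_rel_sym.
move: cc' => /existsP[p2 /existsP[q2 /and3P[pq /eqP eu' /eqP ev']]].
move: h1 h2; rewrite -!(copy_mapK c) -eu -ev eu' ev' !copy_mapK.
have := pi_hom pq; have := pi_xy pq; have := pi_xy (p := q2) (q := p2); rewrite adj_sym pq => /(_ isT).
case: eqP => [->|_]; case: eqP => [->|_] //=; case: eqP => [->|_] //=; case: eqP => [->|_] //=;
  by rewrite adj_irrefl.
Qed.

End PartiteAmalgam.

(** Invariant of the induction in which [D] collects the edges of [F] treated so far. Asking that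
    [f] be a section of [pi] makes it injective and locates its vertices over the next edge. *)
Definition forces (F : sgraph) (g d : nat) (D : rel F) : Prop :=
  exists (P : sgraph) (pi : P -> F), [/\ forall p q, adj p q -> D (pi p) (pi q),
    forall c : seq P, cycle (@adj P) c -> size c != g &
    forall (e : rel P) (es : symmetric e) (ei : irreflexive e),
      subrel (@adj P) e -> VC_dim (SGraph es ei) <= d ->
      exists2 f : F -> P, (forall x, pi (f x) = x) & forall x y, D x y -> e (f x) (f y)].

(** In an extension of small VC-dimension, [bipartite_ramsey] yields an admissible copy of [P] whose
    fibres over [x] and [y] are completely joined. The section found inside this copy realizes [D]
    and also the edge [x y]. *)
Lemma forces_add (F : sgraph) (g d : nat) (D : rel F) (x y : F) :
  odd g -> (forall c : seq F, cycle (@adj F) c -> odd (size c) -> g <= size c) ->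
  subrel D (@adj F) -> symmetric D -> adj x y -> ~~ D x y -> forces g d D ->
  forces g d (fun a b => [|| D a b, (a == x) && (b == y) | (a == y) && (b == x)]).
Proof.
move=> og gm DF Ds xy Dxy [P [pi [pD Pg Pe]]].
have pi_hom p q : adj p q -> adj (pi p) (pi q) by move/pD/DF.
have pi_xy p q : adj p q -> ~~ ((pi p == x) && (pi q == y)).
  by move/pD => h; apply: contra Dxy => /andP[/eqP<- /eqP<-].
have [X [Y [E hE]]] := bipartite_ramsey P d.
exists (amalgam_graph x y E pi_hom), (@amalgam_proj F P pi x y X Y); split.
- move=> u v /or3P[||/existsP[c /andP[_ /existsP[p /existsP[q /and3P[pq /eqP-> /eqP->]]]]]].
  + by case: u => [[]|] //; case: v => [[]|] //= *; rewrite !eqxx orbT.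
  + by case: u => [[]|] //; case: v => [[]|] //= *; rewrite !eqxx !orbT.
  by rewrite !copy_mapK pD.
- exact: (amalgam_cycle pi_xy og gm xy Pg).
move=> e es ei sub vc.
have [||a [b [ai bi hab]]] := hE (fun a b => e (inX P Y a) (inY P X b)).
- by move=> a b Eab; apply: sub; rewrite /= /amalgam_rel /= Eab.
- move=> S hS; apply: leq_trans vc.
  exact: (@shatters_VC_dim (SGraph es ei) X Y (@inX P X Y) (@inY P X Y) S hS).
pose c : copy P X Y := (finfun a, finfun b).
have ac : admissible E c.
  apply/and3P; split.
  - by apply/injectiveP => p q; rewrite !ffunE => /ai.
  - by apply/injectiveP => p q; rewrite !ffunE => /bi.
  by apply/forallP => p; apply/forallP => q; rewrite !ffunE; case/andP: (hab p q).
pose Q := pullback (G := SGraph es ei) (copy_map pi x y c).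
have [||f fs fD] := Pe (@adj Q) (@adj_sym Q) (@adj_irrefl Q).
- move=> p q pq; apply: sub; apply/or3P/Or33/existsP; exists c; rewrite ac.
  by apply/existsP; exists p; apply/existsP; exists q; rewrite pq !eqxx.
- exact: leq_trans (VC_dim_pullback (G := SGraph es ei) _) vc.
exists (fun z => copy_map pi x y c (f z)) => [z|]; first by rewrite copy_mapK.
have exy : e (copy_map pi x y c (f x)) (copy_map pi x y c (f y)).
  rewrite /copy_map !fs !eqxx; case: eqP => [yx|_]; first by move: xy; rewrite yx adj_irrefl.
  by rewrite !ffunE; case/andP: (hab (f x) (f y)).
move=> u v /or3P[/fD // | /andP[/eqP-> /eqP->] // | /andP[/eqP-> /eqP->]].
by rewrite es.
Qed.

(** The pairs of vertices of [F] are treated one by one, starting from the edgeless graph on [F].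
    Odd closed walks of [L] project to [F], so have length at least [g]; the invariant excludes [g]
    itself. *)
Lemma rigid_graph (F : sgraph) (g d : nat) :
  odd g -> (forall c : seq F, cycle (@adj F) c -> odd (size c) -> g <= size c) ->
  exists L : sgraph,
    (forall c : seq L, cycle (@adj L) c -> odd (size c) -> g < size c) /\
    forall (e : rel L) (es : symmetric e) (ei : irreflexive e),
      subrel (@adj L) e -> VC_dim (SGraph es ei) <= d -> contains F (SGraph es ei).
Proof.
move=> og gm.
pose D (s : seq (F * F)) : rel F := fun a b => adj a b && (((a, b) \in s) || ((b, a) \in s)).
have Ds s : symmetric (D s) by move=> a b; rewrite /D adj_sym orbC.
have DF s : subrel (D s) (@adj F) by move=> a b /andP[].
have eq_forces (D1 D2 : rel F) : D1 =2 D2 -> forces g d D1 -> forces g d D2.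
  move=> h [P [pi [h1 h2 h3]]]; exists P, pi; split=> //.
    by move=> p q /h1; rewrite h.
  by move=> e es ei se vc; have [f f1 f2] := h3 e es ei se vc; exists f => // x y; rewrite -h => /f2.
have all s : forces g d (D s).
  elim: s => [|[x y] s IH].
    pose P := SGraph (fun x y : F => erefl false) (fun x : F => erefl false).
    exists P, id; split=> //; first by case=> [|a [|b c]] //=; rewrite eq_sym; case: (g) og.
    by move=> e es ei _ _; exists id => // a b /andP[].
  have [/andP[xy Dxy]|] := boolP (adj x y && ~~ D s x y).
    apply: eq_forces (forces_add og gm (DF s) (Ds s) xy Dxy IH) => a b.
    rewrite /D !in_cons !xpair_eqE.
    case: (boolP (adj a b)) => [_|nab] /=.
      by case: (a == x); case: (b == y); case: (a == y); case: (b == x) => //=; rewrite ?orbT ?orbF.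
    apply/negP => /orP[] /andP[/eqP ax /eqP bx]; move: nab; rewrite ax bx ?xy // adj_sym xy //.
  rewrite negb_and negbK => h; apply: eq_forces IH => a b.
  rewrite /D !in_cons !xpair_eqE; case: (boolP (adj a b)) => //= ab.
  have k u v : adj u v -> (u == x) && (v == y) -> ((u, v) \in s) || ((v, u) \in s).
    move=> uv /andP[/eqP ux /eqP vy]; move: uv h; by rewrite ux vy /D => ->.
  have := k a b ab; have := k b a; rewrite adj_sym ab => /(_ isT).
  case: (_ && _); case: (_ && _) => //=; rewrite ?orbT // => h1 h2;
    by [apply: h2 | rewrite orbC; apply: h1].
have [L [pi [h1 h2 h3]]] := all (enum {: F * F}); exists L; split=> [c cc oc|e es ei se vc].
  rewrite ltn_neqAle eq_sym h2 //=; have cm : cycle (@adj F) (map pi c).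
    by rewrite cycle_map; apply: sub_cycle cc => u v /h1/DF.
  by have := gm _ cm; rewrite size_map; apply.
have [f f1 f2] := h3 e es ei se vc; exists f; split=> [x y exy|x y xy].
  by rewrite -(f1 x) exy f1.
by apply: f2; rewrite /D xy mem_enum.
Qed.

(** * Reassembling H from a core and independent classes *)

(** The core is placed by [f] and the independent classes by [h]; images in different classes are
    adjacent, hence distinct. *)
Lemma contains_of_core (H G : sgraph) (k : nat) (rho : H -> 'I_k.+1) (f : core rho -> G) (h : H -> G) :
  independent_off_0 rho -> injective f -> (forall u v, adj u v -> adj (f u) (f v)) ->
  (forall x y, rho x != ord0 -> rho x = rho y -> h x = h y -> x = y) ->
  (forall x y, rho x != ord0 -> rho y != ord0 -> rho x != rho y -> adj (h x) (h y)) ->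
  (forall u x, rho x != ord0 -> adj (f u) (h x)) -> contains H G.
Proof.
move=> ind fi fe hi he fh.
pose phi x := if insub x is Some u then f u else h x.
have phiP x : (exists2 u : core rho, val u = x & phi x = f u) \/ rho x != ord0 /\ phi x = h x.
  rewrite /phi; case: insubP => [u _ <-|]; first by left; exists u.
  by rewrite inE; right.
have neq (u v : G) : adj u v -> u <> v by move=> + e; rewrite e adj_irrefl.
exists phi; split.
  move=> x y; case: (phiP x) => [[u <- ->]|[rx ->]]; case: (phiP y) => [[v <- ->]|[ry ->]].
  - by move/fi => ->.
  - by move/neq: (fh u _ ry).
  - by move/esym => e; move: (fh v _ rx) => /neq.
  have [rxy|rxy] := eqVneq (rho x) (rho y); first exact: hi.
  by move/neq: (he _ _ rx ry rxy).
move=> x y; case: (phiP x) => [[u ux ->]|[rx ->]]; case: (phiP y) => [[v vy ->]|[ry ->]] xy.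
- by apply: fe; rewrite /= ux vy.
- exact: fh.
- by rewrite adj_sym fh.
by apply: he => //; apply: contra rx => /eqP/(ind _ _ xy)/eqP.
Qed.

Lemma colorable_of_core (H : sgraph) (k : nat) (rho : H -> 'I_k.+1) :
  independent_off_0 rho -> colorable (core rho) 2 -> colorable H k.+2.
Proof.
move=> ind /colorableP[c hc]; apply/colorableP.
(* The core uses colours 0 and 1; a nonzero label [i] gets the colour [i.+1], which is at least
   2. *)
pose col x : nat := if insub x is Some u then c u : nat else (rho x).+1.
have colP x : (exists2 u : core rho, val u = x & col x = c u) \/ rho x != ord0 /\ col x = (rho x).+1.
  rewrite /col; case: insubP => [u _ <-|]; first by left; exists u.
  by rewrite inE; right.
have lt x : col x < k.+2.
  case: (colP x) => [[u _ ->]|[_ ->]]; last by rewrite ltnS.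
  exact: leq_trans (ltn_ord _) _.
have big x : rho x != ord0 -> 0 < rho x by rewrite -val_eqE lt0n.
exists (fun x => Ordinal (lt x)) => x y xy; rewrite -val_eqE /=.
case: (colP x) => [[u ux ->]|[rx ->]]; case: (colP y) => [[v vy ->]|[ry ->]].
- by rewrite val_eqE hc //= ux vy.
- by have := ltn_ord (c u); have := big _ ry; lia.
- by have := ltn_ord (c v); have := big _ rx; lia.
by rewrite eqSS val_eqE; apply: contra rx => /eqP/(ind _ _ xy)/eqP.
Qed.

(** No core is bipartite, so each has a shortest odd closed walk; [rho] is chosen among the finitely
    many labellings to maximize its length. *)
Lemma core_max_odd_girth (H : sgraph) (k : nat) : ~~ colorable H k.+2 ->
  exists (rho : H -> 'I_k.+1) (g : nat), [/\ independent_off_0 rho, odd g,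
    forall c : seq (core rho), cycle (@adj (core rho)) c -> odd (size c) -> g <= size c &
    forall rho' : H -> 'I_k.+1, independent_off_0 rho' ->
      exists c : seq (core rho'), [/\ cycle (@adj (core rho')) c, odd (size c) & size c <= g]].
Proof.
move=> nc.
have /choice[og ogP] (rho : {ffun H -> 'I_k.+1}) : exists g, independent_off_0 rho ->
    (exists c : seq (core rho), [/\ cycle (@adj (core rho)) c, odd (size c) & size c = g]) /\
    forall c : seq (core rho), cycle (@adj (core rho)) c -> odd (size c) -> g <= size c.
  have [ind|] := pselect (independent_off_0 rho); last by exists 0.
  have ex : exists g, `[< exists c : seq (core rho), [/\ cycle (@adj (core rho)) c, odd (size c) & size c = g] >].
    apply: contrapT => no; move/negP: nc; apply; apply: (colorable_of_core ind).
    apply: colorable2_of_no_odd_cycle => c cc; apply/negP => oc; apply: no.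
    by exists (size c); apply/asboolP; exists c.
  case: (ex_minnP ex) => g /asboolP hg gm; exists g => _; split=> // c cc oc.
  by apply: gm; apply/asboolP; exists c.
have i0 : `[< independent_off_0 [ffun _ : H => @ord0 k] >].
  by apply/asboolP => x y _; rewrite !ffunE.
have [rho /asboolP ri rm] := @arg_maxnP _ [ffun _ : H => @ord0 k]
  (fun rho : {ffun H -> 'I_k.+1} => `[< independent_off_0 rho >]) og i0.
have [[c [_ oc sc]] gm] := ogP _ ri.
exists rho, (og rho); split=> //; first by rewrite -sc.
move=> rho' ri'; have e : (finfun rho' : H -> 'I_k.+1) = rho' by apply/funext => x; rewrite ffunE.
rewrite -e in ri' *; have [[c' [cc' oc' sc']] _] := ogP _ ri'.
by exists c'; split=> //; rewrite sc'; apply: rm; apply/asboolP.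
Qed.

Lemma maximal_free_large_VC (H : sgraph) (k C : nat) : ~~ colorable H k.+2 ->
  exists G : sgraph, [/\ maximal_free H G, 0 < #|G|, k * #|G| <= k.+1 * min_degree G & C < VC_dim G].
Proof.
move=> /core_max_odd_girth[rho [g [ri og gm gmax]]].
(* Taking [d] at least [#|H|] forces [L] to have more than [#|H|] vertices, so that each further
   part has room for an independent class of [H]. *)
pose d := maxn C #|H|; have [L [Lg Le]] := rigid_graph d og gm.
have no_core (rho' : H -> 'I_k.+1) : independent_off_0 rho' -> ~ contains (core rho') L.
  move=> /gmax[c [cc oc cg]] [f [_ fe]].
  have cL : cycle (@adj L) (map f c) by rewrite cycle_map; apply: sub_cycle cc => u v /fe.
  by have := Lg _ cL; rewrite size_map => /(_ oc); rewrite ltnNge cg.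
have dL : d < VC_dim L.
  rewrite ltnNge; apply/negP => vc; apply: (no_core rho ri).
  by case: L Le vc {Lg no_core} => V e es ei Le vc; apply: Le.
have HL : #|H| < #|L|.
  have h : #|H| < 2 ^ VC_dim L.
    by apply: ltn_trans (ltn_expl _ (ltnSn 1)); apply: leq_trans dL; rewrite ltnS leq_maxr.
  have := leq_trans h (VC_dim_exp L); rewrite leq_max => /orP[|//].
  rewrite ltnS leqn0 => /eqP H0.
  have : 1 < 2 ^ VC_dim L by rewrite -{1}(expn0 2) ltn_exp2l // (leq_trans _ dL).
  by move/leq_trans/(_ (VC_dim_exp L)); rewrite leq_max H0 => /orP[//|/ltnW].
have Gfree : Defs.free H (multipartite L k).
  by move/contains_multipartite => [rho' ri' /no_core]; apply.
have [e [es [ei [se me]]]] := maximal_free_extension Gfree.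
exists (SGraph es ei); split=> //.
- by rewrite card_multipartite muln_gt0 /=; apply: leq_ltn_trans HL.
- rewrite [#|_|](card_multipartite L k) mulnCA leq_mul2l /=.
  exact: leq_trans (min_degree_multipartite L k) (min_degree_subrel es ei se).
rewrite ltnNge; apply/negP => vc; case: me => Hfree _; apply: Hfree.
(* Part [ord0] of the extension still extends [L]. With small VC-dimension it would contain the
   core, and the other parts would complete a copy of [H]. *)
pose inc (x : L) : SGraph es ei := (ord0, x).
have [||f [fi fe]] := Le (@adj (pullback inc)) (@adj_sym (pullback inc)) (@adj_irrefl (pullback inc)).
- by move=> x y xy; apply: se; rewrite /= /multipartite_rel /= xy.
- apply: leq_trans (leq_trans vc (leq_maxl _ _)); exact: (VC_dim_pullback inc).
have [h hinj _] : exists2 h : H -> L, injective h & forall x, h x \in setT.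
  by apply: inj_into; rewrite cardsT ltnW.
have e_neq (i j : 'I_k.+1) x y : i != j -> e (i, x) (j, y).
  by move=> ij; apply: se; rewrite /= /multipartite_rel /= ij.
apply: (@contains_of_core H (SGraph es ei) k rho (inc \o f) (fun x => (rho x, h x))) => //.
- by move=> u v [/fi].
- by move=> x y _ _ [_ /hinj].
- by move=> x y _ _; apply: e_neq.
by move=> u x rx; apply: e_neq; rewrite eq_sym.
Qed.

(** * Copies of complete multipartite graphs in neighbourhoods *)

Lemma exp_le_ffact (a s : nat) : 2 * s <= a -> a ^ s <= 2 ^ s * a ^_ s.
Proof.
move=> sa; have h i : i <= s -> a ^ i <= 2 ^ i * a ^_ i.
  elim: i => // i IH si; rewrite expnSr ffactnSr expnSr.
  have := IH (ltnW si); have : a <= 2 * (a - i) by lia.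
  set u := a ^ i; set v := 2 ^ i; set w := a ^_ i => h1 h2.
  rewrite (_ : v * 2 * (w * (a - i)) = (v * w) * (2 * (a - i))); last by nia.
  exact: leq_mul.
exact: h.
Qed.

(** By averaging, a proportion [1 / (2 * e)] of the [y] satisfy [Q y] on a proportion [1 / (2 * e)]
    of [V]. Each of these admits many injective [s]-tuples, as a falling factorial loses at most a
    factor [2 ^ s]. *)
Lemma dense_injections (Y V : finType) (s e : nat) (Q : Y -> V -> bool) :
  0 < #|V| -> 4 * e * s <= #|V| -> #|Y| * #|V| <= e * \sum_y \sum_x Q y x ->
  #|Y| * #|{ffun 'I_s -> V}| <= 2 * e * (4 * e) ^ s *
    \sum_y \sum_(f : {ffun 'I_s -> V}) (injectiveb f && [forall a, Q y (f a)]).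
Proof.
move=> V0 Vs hQ; pose a y := #|[set x | Q y x]|.
have sa y : \sum_x Q y x = a y by rewrite -big_mkcond /= sum1dep_card.
have sf y : \sum_(f : {ffun 'I_s -> V}) (injectiveb f && [forall a, Q y (f a)]) = a y ^_ s.
  rewrite -big_mkcond /= sum1dep_card -[in RHS](card_ord s) -card_inj_ffuns_on.
  rewrite cardsE; apply: eq_card => f; rewrite !inE andbC; congr (_ && _).
  apply/forallP/ffun_onP => h i; first by rewrite inE.
  by have := h i; rewrite inE.
rewrite (eq_bigr _ (fun y _ => sf y)); rewrite (eq_bigr _ (fun y _ => sa y)) in hQ.
pose good := [set y | #|V| <= 2 * e * a y].
have hgood : #|Y| <= 2 * e * #|good|.
  rewrite -(leq_pmul2r V0).
  have : 2 * e * \sum_y a y <= 2 * e * #|good| * #|V| + #|Y| * #|V|.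
    rewrite (bigID (mem good)) mulnDr leq_add //=.
      rewrite -[X in _ <= X]mulnA leq_mul2l -sum_nat_const; apply/orP; right; apply: leq_sum => y _.
      exact: max_card.
    rewrite big_distrr -sum_nat_const [X in _ <= X](bigID (mem good)) /=.
    apply: leq_trans (leq_addl _ _); apply: leq_sum => y; rewrite inE -ltnNge.
    exact: ltnW.
  by move: hQ; set S := \sum_y _; set u := #|Y| * #|V|; set v := _ * #|V|; lia.
have hs y : y \in good -> #|V| ^ s <= (4 * e) ^ s * a y ^_ s.
  rewrite inE => hy; have [s0|s0] := posnP s; first by rewrite s0 !expn0.
  have e0 : 0 < e by case: (posnP e) hy V0 => // ->; rewrite muln0 mul0n leqn0 => /eqP ->.
  have : 2 * s <= a y by have := leq_trans Vs hy; nia.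
  move/exp_le_ffact => h; apply: (leq_trans (leq_exp2rW s hy)).
  rewrite expnMn (_ : 4 * e = 2 * e * 2); last by lia.
  by rewrite [in X in _ <= X]expnMn -mulnA leq_mul2l h orbT.
rewrite card_ffun card_ord; apply: (leq_trans (leq_mul hgood (leqnn _))).
rewrite -!mulnA !leq_mul2l /=; apply/orP; right.
rewrite -sum_nat_const big_distrr [X in _ <= X](bigID (mem good)) /=.
by apply: leq_trans (leq_addr _ _); apply: leq_sum => y; apply: hs.
Qed.

(** Nested pairs let the predicates below recurse on [k] by splitting off the first entry. *)
Fixpoint power (T : finType) (k : nat) : finType :=
  if k is k'.+1 then (T * power T k')%type : finType else unit : finType.

Lemma card_power (T : finType) (k : nat) : #|power T k| = #|T| ^ k.
Proof. by elim: k => [|k IH]; [rewrite card_unit | rewrite card_prod IH expnS]. Qed.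

(* For s > 0: the k tuples are injective and Q holds for every choice of one entry from each. *)
Fixpoint blowup (V : finType) (s k : nat) : (power V k -> bool) -> power {ffun 'I_s -> V} k -> bool :=
  match k with
  | 0 => fun Q _ => Q tt
  | k'.+1 => fun Q t =>
      @blowup V s k' (fun t' => injectiveb t.1 && [forall a, Q (t.1 a, t')]) t.2
  end.

Lemma sum_power_S (T : finType) (k : nat) (F : power T k.+1 -> nat) :
  \sum_t F t = \sum_(x : T) \sum_(t : power T k) F (x, t).
Proof. by rewrite pair_bigA; apply: eq_bigr => -[]. Qed.

Lemma dense_blowup (s k e : nat) : exists e' n0, forall (Y V : finType) (Q : Y -> power V k -> bool),
  n0 <= #|V| -> #|Y| * #|power V k| <= e * \sum_y \sum_t Q y t ->
  #|Y| * #|power {ffun 'I_s -> V} k| <= e' * \sum_y \sum_t @blowup V s k (Q y) t.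
Proof.
elim: k e => [|k IH] e; first exists e, 0 => Y V Q _ h.
  by apply: (leq_trans h); rewrite leq_mul2l; apply/orP; right; apply: leq_sum => y _; apply: leq_sum => -[].
have [e' [n0 h]] := IH (2 * e * (4 * e) ^ s); exists e', (maxn (4 * e * s).+1 n0).
move=> Y V Q; rewrite geq_max => /andP[n1 n2] hQ.
pose Q1 (yt : Y * power V k) (x : V) := Q yt.1 (x, yt.2).
have := @dense_injections _ V s e Q1 (leq_trans _ n1) (ltnW n1).
have h1 : #|{: Y * power V k}| * #|V| <= e * \sum_y \sum_x Q1 y x.
  rewrite card_prod -mulnA [#|power V k| * _]mulnC -card_prod; apply: (leq_trans hQ).
  rewrite leq_mul2l -(pair_bigA _ (fun y t => \sum_x Q1 (y, t) x)) /=; apply/orP; right.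
  apply: eq_leq; apply: eq_bigr => y _; rewrite sum_power_S exchange_big.
  by [].
move=> /(_ isT h1) h2.
pose Q2 (yf : Y * {ffun 'I_s -> V}) (t : power V k) :=
  injectiveb yf.2 && [forall a, Q yf.1 (yf.2 a, t)].
have := h _ V Q2 n2; rewrite !card_prod.
have h3 : #|Y| * #|{ffun 'I_s -> V}| * #|power V k| <= 2 * e * (4 * e) ^ s * \sum_y \sum_t Q2 y t.
  rewrite -mulnA [#|{ffun 'I_s -> V}| * _]mulnC mulnA -card_prod; apply: (leq_trans h2).
  rewrite leq_mul2l -(pair_bigA _ (fun y t => \sum_(f : {ffun 'I_s -> V})
    (injectiveb f && [forall a, Q1 (y, t) (f a)]))) -(pair_bigA _ (fun y f => \sum_t Q2 (y, f) t)) /=.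
  by apply/orP; right; apply: eq_leq; apply: eq_bigr => y _; rewrite exchange_big.
move=> /(_ h3); rewrite -mulnA => h4; apply: (leq_trans h4); rewrite leq_mul2l; apply/orP; right.
rewrite -(pair_bigA _ (fun y f => \sum_t @blowup V s k (Q2 (y, f)) t)) /=.
by apply: eq_leq; apply: eq_bigr => y _; rewrite sum_power_S.
Qed.

Fixpoint clique (G : sgraph) (k : nat) (U : {set G}) : power G k -> bool :=
  match k with
  | 0 => fun _ => true
  | k'.+1 => fun t => (t.1 \in U) && @clique G k' (U :&: nbhd t.1) t.2
  end.

Fixpoint joined (G : sgraph) (s k : nat) (U : {set G}) : power {ffun 'I_s -> G} k -> bool :=
  match k with
  | 0 => fun _ => true
  | k'.+1 => fun t => [&& injectiveb t.1, [forall a, t.1 a \in U] &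
      @joined G s k' (U :&: [set u | [forall a, adj (t.1 a) u]]) t.2]
  end.

Fixpoint support (G : sgraph) (s k : nat) : power {ffun 'I_s -> G} k -> {set G} :=
  match k with
  | 0 => fun _ => set0
  | k'.+1 => fun t => [set t.1 a | a : 'I_s] :|: @support G s k' t.2
  end.

Lemma card_support (G : sgraph) (s k : nat) (t : power {ffun 'I_s -> G} k) :
  #|support t| <= k * s.
Proof.
elim: k t => [|k IH] t; first by rewrite /= cards0.
rewrite /= cardsU (leq_trans (leq_subr _ _)) // mulSn leq_add //.
by rewrite (leq_trans (leq_imset_card _ _)) // card_ord.
Qed.

(** Whether [t] lies in a neighbourhood thus depends only on the trace of that neighbourhood on
    [support t]. *)
Lemma joined_support (G : sgraph) (s k : nat) (U W : {set G}) (t : power {ffun 'I_s -> G} k) :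
  joined (U :&: W) t = joined W t && (support t \subset U).
Proof.
elim: k W t => [|k IH] W t /=; first by rewrite sub0set.
rewrite -setIA IH subUset -!andbA; congr (_ && _).
have -> : [forall a, t.1 a \in U :&: W] =
    [forall a, t.1 a \in W] && ([set t.1 a | a : 'I_s] \subset U).
  apply/forallP/andP => [h|[/forallP h1 /subsetP h2] a].
    split; first by apply/forallP => a; have := h a; rewrite inE => /andP[].
    by apply/subsetP => _ /imsetP[a _ ->]; have := h a; rewrite inE => /andP[].
  by rewrite inE h1 h2 // imset_f.
by rewrite -!andbA; do !bool_congr.
Qed.

Lemma joinedP (G : sgraph) (s k : nat) (U : {set G}) (t : power {ffun 'I_s -> G} k) : joined U t ->
  exists w : 'I_k -> 'I_s -> G, forall i, [/\ injective (w i),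
    forall a, w i a \in support t & forall j a b, i != j -> adj (w i a) (w j b)].
Proof.
elim: k U t => [|k IH] U t /=; first by exists (fun i : 'I_0 => False_rect _ (notF (ltn_ord i))); case.
case/and3P => /injectiveP inj _ jt; have [w hw] := IH _ _ jt.
have tw i a b : adj (t.1 b) (w i a).
  move: jt; rewrite -[_ :&: _]setIT joined_support => /andP[_ /subsetP/(_ (w i a))].
  have [_ wt _] := hw i; rewrite wt => /(_ isT).
  by rewrite !inE => /andP[_ /forallP].
exists (fun i => if unlift ord0 i is Some j then w j else t.1) => i.
case: unliftP => [i' ->|->]; split=> //.
- by have [] := hw i'.
- by move=> a; rewrite inE; have [_ -> _] := hw i'; rewrite orbT.
- move=> j a b; case: unliftP => [j' ->|-> _]; last by rewrite adj_sym.
  by rewrite (inj_eq lift_inj); have [_ _] := hw i'; apply.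
- by move=> a; rewrite inE imset_f.
by move=> j a b; case: unliftP => [j' -> _ //|->]; rewrite eqxx.
Qed.

Lemma clique_bigcap (G : sgraph) (s k : nat) (W : 'I_s.+1 -> {set G}) (U : {set G}) (t : power G k) :
  (forall u, (forall a, u \in W a) -> u \in U) -> (forall a, clique (W a) t) -> clique U t.
Proof.
elim: k W U t => //= k IH W U t WU h; apply/andP; split.
  by apply: WU => a; case/andP: (h a).
apply: (IH (fun a => W a :&: nbhd t.1)) => [u hu|a]; last by case/andP: (h a).
rewrite inE WU => [|a]; first by have := hu ord0; rewrite inE => /andP[].
by have := hu a; rewrite inE => /andP[].
Qed.

Lemma blowup_sat (V : finType) (s k : nat) (Q : power V k -> bool) (t : power {ffun 'I_s.+1 -> V} k) :
  blowup Q t -> exists t', Q t'.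
Proof.
elim: k Q t => [|k IH] Q t /=; first by exists tt.
by move/IH => [t' /andP[_ /forallP/(_ ord0)]]; exists (t.1 ord0, t').
Qed.

(** The size [s.+1] keeps the parts nonempty; with empty parts, [blowup] would hold vacuously and
    yield no tuple satisfying [Q]. *)
Lemma blowup_clique (G : sgraph) (s k : nat) (U : {set G}) (Q : power G k -> bool)
    (t : power {ffun 'I_s.+1 -> G} k) :
  (forall t', Q t' -> clique U t') -> blowup Q t -> joined U t.
Proof.
elim: k U Q t => //= k IH U Q t QU bt.
have [t' /andP[-> /forallP ht]] := blowup_sat bt.
rewrite /=; apply/andP; split; first by apply/forallP => a; case/andP: (QU _ (ht a)).
apply: IH bt => t'' /= /andP[_ /forallP ht''].
apply: (clique_bigcap (W := fun a => U :&: nbhd (t.1 a))) => [u hu|a].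
  rewrite !inE; have := hu ord0; rewrite inE => /andP[-> _]; apply/forallP => a.
  by have := hu a; rewrite !inE => /andP[].
by case/andP: (QU _ (ht'' a)).
Qed.

(** With [n] vertices and minimum degree [m], the hypothesis reads
    [#|U| >= n / e + (k - 1) * (n - m)]. Each chosen vertex removes at most [n - m] candidates, so
    [n / e] remain at every choice. *)
Lemma count_cliques (G : sgraph) (e k : nat) (U : {set G}) :
  (0 < k -> (e * k.-1 + 1) * #|G| <= e * #|U| + e * k.-1 * min_degree G) ->
  #|G| ^ k <= e ^ k * \sum_t @clique G k U t.
Proof.
elim: k U => [|k IH] U hU.
  by rewrite !expn0 mul1n (eq_bigr (fun _ => 1)) // sum1_card card_unit.
have {}hU := hU isT; rewrite /= in hU.
have dn := min_degree_card G.
have eU : #|G| <= e * #|U|.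
  have : e * k * min_degree G <= e * k * #|G| by rewrite leq_mul2l dn orbT.
  by move: hU; set a := #|U|; set n := #|G|; set m := min_degree G; clear; nia.
have step x : #|G| ^ k <= e ^ k * \sum_t @clique G k (U :&: nbhd x) t.
  apply: IH => k0.
  have hx : #|U| + min_degree G <= #|U :&: nbhd x| + #|G|.
    apply: (leq_trans (leq_add (leqnn _) (min_degree_le x))).
    by rewrite /degree -cardsUI addnC leq_add2l max_card.
  case: k k0 hU => // k _ /= hU.
  have := leq_mul (leqnn e) hx; move: hU.
  set a := #|U|; set b := #|_ :&: _|; set n := #|G|; set m := min_degree G; clear; nia.
have low : \sum_(x in U) \sum_t @clique G k (U :&: nbhd x) t <= \sum_t @clique G k.+1 U t.
  rewrite sum_power_S [X in _ <= X](bigID (mem U)); apply: leq_trans (leq_addr _ _).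
  by apply: leq_sum => x xU; apply: leq_sum => t _; rewrite /= [x \in U]xU.
apply: leq_trans (leq_mul (leqnn _) low); rewrite !expnS.
apply: (leq_trans (leq_mul eU (leqnn _))).
rewrite -!mulnA leq_mul2l -sum_nat_const big_distrr; apply/orP; right.
by apply: leq_sum => x _; apply: step.
Qed.

Lemma bounded_cover (k s d e : nat) : exists K n0, forall G : sgraph,
  n0 <= #|G| -> VC_dim G <= d -> (e * k + 1) * #|G| <= e * k.+1 * min_degree G ->
  exists2 T : {set power {ffun 'I_s.+1 -> G} k.+1}, #|T| <= K &
    forall v, exists2 t, t \in T & joined (nbhd v) t.
Proof.
have [e' [n0 he']] := dense_blowup s.+1 k.+1 (e ^ k.+1).
have [K hK] := @eps_net_bounded e'.+1 (k.+1 * s.+1) d isT.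
exists K, (maxn 1 n0) => G; rewrite geq_max => /andP[G0 Gn] vc hd.
pose A (v : G) := [set t : power {ffun 'I_s.+1 -> G} k.+1 | joined (nbhd v) t].
have [|v|J z|T TK hT] := hK G _ A.
- by rewrite card_power expn_gt0 card_ffun expn_gt0 G0.
- have := he' unit G (fun _ => clique (nbhd v)) Gn; rewrite card_unit !mul1n.
  have su (F : unit -> nat) : \sum_y F y = F tt.
    by rewrite (bigD1 tt) //= big1 ?addn0 // => -[].
  have cnt : #|power G k.+1| <= e ^ k.+1 * \sum_t @clique G k.+1 (nbhd v) t.
    rewrite card_power; apply: count_cliques => _ /=; apply: (leq_trans hd).
    by rewrite mulnS mulnDl leq_add2r leq_mul2l min_degree_le orbT.
  rewrite !su => /(_ cnt) h; apply: (leq_trans h).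
  apply: leq_mul => //; rewrite -big_mkcond sum1dep_card subset_leq_card //.
  by apply/subsetP => t; rewrite !inE; apply: blowup_clique.
(* The trace of [A v] on the sample is a function of [nbhd v :&: S], and Sauer-Shelah bounds the
   number of such sets. *)
- pose S := \bigcup_(j : J) support (z j).
  have cS : #|S| <= k.+1 * s.+1 * #|J|.
    apply: (leq_trans (card_bigcup_le _ _)).
    apply: (@leq_trans (\sum_(j : J) k.+1 * s.+1)); first by apply: leq_sum => j _; apply: card_support.
    by rewrite sum_nat_const mulnC.
  pose traces := [set nbhd v :&: S | v : G].
  have tS : #|traces| <= #|S|.+1 ^ d.
    apply: sauer_shelah => [_ /imsetP[v _ ->]|W hW]; first exact: subsetIr.
    apply: leq_trans vc; apply: (@shatters_VC_dim G G G id id).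
    have WS : W \subset S.
      have [_ /imsetP[v _ ->] ->] := shattersP _ _ hW _ (subxx W).
      by rewrite -setIA [S :&: _]setIC setIA subsetIr.
    apply/shattersP => V VW; have [_ /imsetP[v _ ->] ->] := shattersP _ _ hW _ VW.
    exists (nbhd v); first by rewrite imset_f.
    by rewrite -setIA (setIidPr WS).
  apply: leq_trans (leq_trans tS _); last by apply: leq_exp2rW.
  have trE v : [set j | z j \in A v] = [set j | joined (nbhd v :&: S) (z j)].
    apply/setP => j; rewrite [LHS]inE [LHS]inE [RHS]inE.
    have js (W : {set G}) : joined W (z j) = joined setT (z j) && (support (z j) \subset W).
      by rewrite -joined_support setIT.
    by rewrite js [in RHS]js subsetI (bigcup_sup j) // andbT.
  rewrite (eq_imset _ trE) (imset_comp (fun B => [set j | joined B (z j)]) (fun v => nbhd v :&: S)).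
  exact: leq_imset_card.
by exists T => // v; have [t tT] := hT v; rewrite inE; exists t.
Qed.

(** * Colouring by common neighbourhoods *)

Lemma colorable_finType (G : sgraph) (D : finType) (c : G -> D) :
  (forall x y, adj x y -> c x != c y) -> colorable G #|D|.
Proof.
move=> hc; apply/colorableP; exists (fun x => enum_rank (c x)) => x y /hc.
by rewrite (inj_eq (@enum_rank_inj D)).
Qed.

(** The [k.+1] parts of [t] host the independent classes, each with room for all of [H], and are
    joined to every common neighbour: a core there would give a copy of [H]. *)
Lemma core_free_common_nbhd (H G : sgraph) (k : nat) (t : power {ffun 'I_#|H|.+1 -> G} k.+1)
    (rho : H -> 'I_k.+2) (v0 : G) :
  Defs.free H G -> independent_off_0 rho -> joined (nbhd v0) t ->
  ~ contains (core rho) (induced [set v | joined (nbhd v) t]).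
Proof.
move=> HG ind jt [f [fi fe]]; apply: HG; have [w hw] := joinedP jt.
pose a (x : H) : 'I_#|H|.+1 := widen_ord (leqnSn _) (enum_rank x).
have ai : injective a by move=> x y /(congr1 val) /= /ord_inj /enum_rank_inj.
pose h x := if unlift ord0 (rho x) is Some i then w i (a x) else v0.
have hP x : rho x != ord0 -> exists2 i, rho x = lift ord0 i & h x = w i (a x).
  by rewrite /h; case: unliftP => [i -> _|->]; [exists i | rewrite eqxx].
apply: (contains_of_core (f := fun u => val (f u)) (h := h) ind) => [u v|u v|x y|x y|u x].
- by move/val_inj/fi.
- exact: fe.
- move=> /hP[i -> ->] e; have [|j ej ->] := hP y; first by rewrite -e.
  by move: e; rewrite ej => /lift_inj <- ; have [wi _ _] := hw i => /wi/ai.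
- move=> /hP[i -> ->] /hP[j -> ->]; rewrite (inj_eq lift_inj).
  by have [_ _] := hw i; apply.
move=> /hP[i _ ->]; have [_ /(_ (a x)) wt _] := hw i.
have := valP (f u); rewrite inE -[nbhd _]setIT joined_support => /andP[_ /subsetP/(_ _ wt)].
by rewrite inE.
Qed.

(** A vertex is coloured by a tuple of the cover inside its neighbourhood, together with its colour
    in the common neighbourhood of that tuple. Graphs with fewer than [n0] vertices get all colours
    distinct. *)
Lemma chromatic_bound (H : sgraph) (k d e C : nat) :
  (forall L : sgraph, (forall rho : H -> 'I_k.+2, independent_off_0 rho -> ~ contains (core rho) L) ->
     colorable L C) ->
  exists C', forall G : sgraph, Defs.free H G -> VC_dim G <= d ->
    (e * k + 1) * #|G| <= e * k.+1 * min_degree G -> chromatic_number G <= C'.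
Proof.
move=> hC; have [K [n0 hK]] := bounded_cover k #|H| d e.
exists (maxn n0 (K * C)) => G HG vc hd; rewrite leq_max.
have [Gn|/hK/(_ vc hd)[T TK cover]] := ltnP #|G| n0.
  apply/orP; left; apply: leq_trans (ltnW Gn); apply/chromatic_number_leP.
  by apply: (@colorable_finType G G id) => x y; apply: contraTneq => ->; rewrite adj_irrefl.
apply/orP; right.
have /choice[c hc] (t : power {ffun 'I_#|H|.+1 -> G} k.+1) : exists c : G -> nat,
    (forall x, joined (nbhd x) t -> c x < C) /\
    forall x y, joined (nbhd x) t -> joined (nbhd y) t -> adj x y -> c x != c y.
  have [[v0 jv0]|no] := pselect (exists v0, joined (nbhd v0) t); last first.
    by exists (fun _ => 0); split=> [x jx|x y jx]; case: no; exists x.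
  have /colorableP[c hc] := hC _ (fun rho ind => core_free_common_nbhd HG ind jv0).
  exists (fun x => if insub x is Some u then c u : nat else 0).
  have ins x : joined (nbhd x) t -> x \in [set v | joined (nbhd v) t] by rewrite inE.
  split=> [x /ins jx|x y /ins jx /ins jy xy]; first by rewrite insubT.
  by rewrite !insubT /= (inj_eq val_inj) hc.
have /choice[t ht] v : exists t, t \in T /\ joined (nbhd v) t.
  by have [t tT jt] := cover v; exists t.
have tT v : t v \in T by case: (ht v).
have cl v : c (t v) v < C by have [h _] := hc (t v); apply: h; case: (ht v).
pose col v : {t | t \in T} * 'I_C := (exist _ (t v) (tT v), Ordinal (cl v)).
apply: (@leq_trans #|{: {t | t \in T} * 'I_C}|).
  apply/chromatic_number_leP; apply: (@colorable_finType G _ col) => x y xy.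
  apply/negP => /eqP[txy cxy]; have [_ h] := hc (t x).
  have jy : joined (nbhd y) (t x) by rewrite txy; case: (ht y).
  by have := h x y (proj2 (ht x)) jy xy; rewrite cxy -txy eqxx.
by rewrite card_prod card_sig card_ord leq_mul2r; apply/orP; right; apply: leq_trans TK; apply: eq_leq; apply: eq_card.
Qed.

(** * Thresholds *)

Local Open Scope ring_scope.

Section Thresholds.

Variables (R : realType) (H : sgraph).

Definition chromatic_bounding : set R := [set gamma | 0 < gamma /\
  exists C : nat, forall G : sgraph, Defs.free H G ->
    gamma * #|G|%:R <= (min_degree G)%:R -> (chromatic_number G <= C)%N]%classic.

Definition VC_bounding : set R := [set gamma | 0 <= gamma /\
  exists C : nat, forall G : sgraph, maximal_free H G ->
    gamma * #|G|%:R <= (min_degree G)%:R -> (VC_dim G <= C)%N]%classic.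

Lemma card0_of_dense (G : sgraph) : 2 * #|G|%:R <= (min_degree G)%:R :> R -> #|G| = 0%N.
Proof.
rewrite -natrM ler_nat => h; have := leq_trans h (min_degree_card G); lia.
Qed.

(** Only the graph without vertices is this dense; the lemma makes the set nonempty, as [inf_lt]
    requires. *)
Lemma chromatic_bounding_2 : chromatic_bounding 2.
Proof.
split=> //; exists 0%N => G _ /card0_of_dense G0; apply/chromatic_number_leP/colorableP.
have no (x : G) : False by have := fintype0 x G0.
by exists (fun x => False_rect _ (no x)) => x; case: (no x).
Qed.

Lemma VC_bounding_2 : VC_bounding 2.
Proof.
split=> //; exists 0%N => G _ /card0_of_dense G0; apply/bigmax_leqP => S _.
by rewrite -G0 max_card.
Qed.

(** If [L] contains no core, then [multipartite L k] is [H]-free, has minimum degree at least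
    [k / k.+1] of its order, and contains [L]. *)
Lemma chromatic_bounding_cores (k : nat) (gamma : R) :
  chromatic_bounding gamma -> gamma * k.+1%:R <= k%:R ->
  exists C, forall L : sgraph,
    (forall rho : H -> 'I_k.+1, independent_off_0 rho -> ~ contains (core rho) L) -> colorable L C.
Proof.
move=> [_ [C hC]] hk; exists C => L noL.
have /hC : Defs.free H (multipartite L k).
  by move/contains_multipartite => [rho ri /noL]; apply.
have h : gamma * #|multipartite L k|%:R <= (min_degree (multipartite L k))%:R.
  apply: (@le_trans _ _ (k * #|L|)%:R); last by rewrite ler_nat min_degree_multipartite.
  by rewrite card_multipartite !natrM mulrA ler_wpM2r ?ler0n.
move=> /(_ h)/chromatic_number_leP; apply: (@colorable_hom L (multipartite L k) (fun x => (ord0, x))).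
by move=> x y xy; rewrite /= /multipartite_rel /= xy.
Qed.

Lemma VC_bounding_ge (k : nat) (gamma : R) :
  ~~ colorable H k.+2 -> VC_bounding gamma -> k%:R / k.+1%:R <= gamma.
Proof.
move=> nc [_ [C hC]]; rewrite leNgt; apply/negP => hk.
have [G [mG G0 kG]] := maximal_free_large_VC C nc; rewrite ltnNge => /negP; apply.
apply: hC => //; rewrite -(ler_pM2l (_ : 0 < k.+1%:R)) ?ltr0n //.
apply: (@le_trans _ _ (k * #|G|)%:R); last by rewrite -natrM ler_nat.
by rewrite natrM mulrA ler_wpM2r ?ler0n // mulrC -ler_pdivlMr ?ltr0n // ltW.
Qed.

Lemma VC_bounding_chromatic (k : nat) (gamma gamma1 : R) :
  VC_bounding gamma -> (3 * k + 1)%N%:R / (3 * k + 4)%N%:R <= gamma ->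
  chromatic_bounding gamma1 -> gamma1 * k.+2%:R <= k.+1%:R ->
  chromatic_bounding gamma.
Proof.
move=> [_ [d hd]] hk /chromatic_bounding_cores h /h {h}[C hC].
(* For [e = 3 * k + 4], [e * k + 1] equals [(3 * k + 1) * k.+1], so the degree condition of
   [chromatic_bound] is exactly the density [(3 * k + 1) / (3 * k + 4)]. *)
have [C' hC'] := chromatic_bound d (3 * k + 4) hC.
split; first by apply: lt_le_trans hk; rewrite divr_gt0 // ltr0n; lia.
exists C' => G HG hG.
have [e [es [ei [se me]]]] := maximal_free_extension HG.
have hG' : gamma * #|SGraph es ei|%:R <= (min_degree (SGraph es ei))%:R.
  by apply: le_trans hG _; rewrite ler_nat min_degree_subrel.
have /chromatic_number_leP hc : (chromatic_number (SGraph es ei) <= C')%N.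
  apply: hC'; [by case: me | exact: hd | ].
  have : ((3 * k + 1) * #|SGraph es ei| <= (3 * k + 4) * min_degree (SGraph es ei))%N.
    rewrite -(ler_nat R) !natrM.
    have p : 0 < (3 * k + 4)%N%:R :> R by rewrite ltr0n; lia.
    apply: (@le_trans _ _ ((3 * k + 4)%N%:R * (gamma * #|SGraph es ei|%:R))).
      by rewrite mulrA ler_wpM2r ?ler0n // mulrC -ler_pdivrMr.
    by rewrite ler_pM2l.
  set n := #|_|; set m := min_degree _; nia.
apply/chromatic_number_leP; exact: (@colorable_hom G (SGraph es ei) id _ se hc).
Qed.

End Thresholds.

Theorem corollary1p10 (R : realType) (H : sgraph) (r : nat)
    (hchi : chromatic_number H = r) (hr : (3 <= r)%N)
    (hthr : chromatic_threshold R H = (r%:R - 3) / (r%:R - 2) \/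
            chromatic_threshold R H = (2 * r%:R - 5) / (2 * r%:R - 3)) :
  chromatic_threshold R H <= VC_threshold R H.
Proof.
rewrite leNgt; apply/negP => lt.
have [g0 g0V g0lt] := inf_lt (ex_intro _ _ (VC_bounding_2 R H)) lt.
have [k rk] : exists k, r = k.+3 by exists (r - 3)%N; lia.
have nc : ~~ colorable H k.+2.
  by apply/negP => /chromatic_number_leP; rewrite hchi rk ltnn.
have g0k := VC_bounding_ge nc g0V.
have rR : r%:R = k%:R + 3 :> R by rewrite rk -addn3 natrD.
have k1R : k.+1%:R = k%:R + 1 :> R by rewrite -natr1.
have k2R : k.+2%:R = k%:R + 2 :> R by rewrite -addn2 natrD.
have k0 : 0 <= k%:R :> R by [].
case: hthr => hthr; move: g0lt; rewrite hthr rR.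
  rewrite addrK (_ : k%:R + 3 - 2 = k.+1%:R :> R); last by rewrite k1R; lra.
  by rewrite ltNge g0k.
(* The mediant of [k / (k + 1)] and [(2 * k + 1) / (2 * k + 3)], hence strictly between them. *)
pose mid : R := (3 * k + 1)%N%:R / (3 * k + 4)%N%:R.
move=> g0lt; set t := _ / _ in g0lt.
have et : t = (2 * k%:R + 1) / (2 * k%:R + 3) by rewrite /t; congr (_ / _); lra.
have midt : mid < t.
  have -> : mid = (3 * k%:R + 1) / (3 * k%:R + 4) by rewrite /mid !(natrD _ (3 * k)%N) natrM.
  rewrite et ltr_pdivrMr; last by lra.
  rewrite mulrAC ltr_pdivlMr; last by lra.
  by nra.
have [|g1 g1C g1lt] := inf_lt (x := k.+1%:R / k.+2%:R) (ex_intro _ _ (chromatic_bounding_2 R H)).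
  rewrite -/(chromatic_threshold R H) hthr rR -/t et k1R k2R ltr_pdivrMr; last by lra.
  by rewrite mulrAC ltr_pdivlMr; [nra | lra].
(* Raising [g0] to at least [mid] keeps it bounding for the VC-dimension and below the chromatic
   threshold, and makes every neighbourhood dense enough for the cover. *)
pose g := Num.max g0 mid.
have gV : VC_bounding H g.
  case: g0V => g00 [C hC]; split; first by rewrite le_max g00.
  exists C => G mG hG; apply: hC => //; apply: le_trans hG.
  by rewrite ler_wpM2r ?ler0n // le_max lexx.
have gC : chromatic_bounding H g.
  apply: (VC_bounding_chromatic (k := k) gV _ g1C); first by rewrite le_max lexx orbT.
  by rewrite -ler_pdivlMr ?ltr0n // ltW.
have gt : g < chromatic_threshold R H by rewrite hthr rR -/t gt_max g0lt.
have : chromatic_threshold R H <= g.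
  by apply: ge_inf => //; exists 0 => x [/ltW].
by rewrite leNgt gt.
Qed.
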